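(* Let $\mathcal{H}$ be a complex Hilbert space and let $f:\mathbb{D}\to\mathcal{B}(\mathcal{H})$ be an operator valued bounded holomorphic function with expansion $f(z)=\sum_{k=0}^{\infty}A_kz^k$ in $\mathbb{D}$, where $A_k\in\mathcal{B}(\mathcal{H})$ for all $k\ge 0$ and $A_0=a_0I$ with $a_0\in\mathbb{C}$, $|a_0|<1$. Let $G(w)=c_1w+c_2w^2+\cdots+c_lw^l$ be a polynomial with $c_i\in\mathbb{R}^{+}$, $i=1,\dots,l$, whose coefficients satisfy $$8c_1\left(\frac{3}{8}\right)^2+24c_2\left(\frac{3}{8}\right)^4+\cdots+8(2l-1)c_l\left(\frac{3}{8}\right)^{2l}\le 1 .$$ If $\|f(z)\|\le 1$ in $\mathbb{D}$, then $$\sum_{k=0}^{\infty}\|A_k\|r^k+G(S(z))\le 1\qquad\text{for } |z|=r\le\frac13,$$ where $S(z)=\sum_{k=1}^{\infty}k\|A_k\|^2r^{2k}$, $|z|=r$. Furthermore, the constant $1/3$ cannot be replaced by a larger quantity, i.e. for every $r\in(1/3,1)$ there is a holomorphic function $f:\mathbb{D}\to\mathcal{B}(\mathcal{H})$, $f(z)=\sum_{k=0}^{\infty}A_kz^k$, with $A_k\in\mathcal{B}(\mathcal{H})$ for all $k\ge 0$, $A_0=a_0I$ for some $a_0\in\mathbb{C}$, $|a_0|<1$, and $\|f(z)\|\le 1$ in $\mathbb{D}$, for which the inequality fails.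
   Context: $\mathbb{D}=\{z\in\mathbb{C}:|z|<1\}$; $\mathcal{B}(\mathcal{H})$ is the algebra of all bounded linear operators on $\mathcal{H}$ with the operator norm $\|\cdot\|$; $I$ is the identity operator on $\mathcal{H}$. The general term of the condition on $G$ is $8(2m-1)c_m(3/8)^{2m}$, $m=1,\dots,l$. *)

(* Defs.v *)
From Stdlib Require Import Reals Lra FunctionalExtensionality ProofIrrelevance.
From Coquelicot Require Import Coquelicot.

Open Scope R_scope.

(** Coquelicot's [is_linear] includes boundedness. *)
Record bounded_operator (V : NormedModule C_AbsRing) : Type := Bop {
  op_fun :> V -> V;
  op_linear : is_linear op_fun
}.
Arguments Bop {V} op_fun op_linear.
Arguments op_fun {V} _ _.
Arguments op_linear {V} _.

Section BoundedOperators.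

Variable V : NormedModule C_AbsRing.
Implicit Types S T U : bounded_operator V.

Lemma bop_ext S T : (forall x, S x = T x) -> S = T.
Proof.
destruct S as [s hs]; destruct T as [t ht]; simpl; intros h.
assert (e : s = t) by (now apply functional_extensionality).
subst t; f_equal; apply proof_irrelevance.
Qed.

Definition op_id : bounded_operator V := Bop (fun x : V => x) is_linear_id.

Definition op_zero : bounded_operator V :=
  Bop (fun _ : V => zero) is_linear_zero.

Lemma is_linear_add S T : is_linear (fun x : V => plus (S x) (T x)).
Proof.
apply (is_linear_comp (fun x : V => (S x, T x))
         (fun p : V * V => plus (fst p) (snd p))).
- apply is_linear_prod; apply op_linear.
- apply is_linear_plus.
Qed.

Definition op_add S T : bounded_operator V := Bop _ (is_linear_add S T).

Lemma is_linear_neg T : is_linear (fun x : V => opp (T x)).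
Proof. apply (is_linear_comp T opp); [apply op_linear | apply is_linear_opp]. Qed.

Definition op_neg T : bounded_operator V := Bop _ (is_linear_neg T).

Lemma is_linear_mulc (a : C) T :
  is_linear (fun x : V => scal (a : C_AbsRing) (T x)).
Proof.
apply (is_linear_comp T (fun y : V => scal (a : C_AbsRing) y)).
- apply op_linear.
- apply is_linear_scal_r; intros n m; apply Cmult_comm.
Qed.

Definition op_scal (a : C) T : bounded_operator V := Bop _ (is_linear_mulc a T).

(** The operator norm, sup over the closed unit ball (so that it is [0] on the
    zero space); finite for every bounded operator by [op_norm_bound]. *)
Definition op_norm T : R :=
  real (Lub_Rbar (fun y => exists x : V, norm x <= 1 /\ y = norm (T x))).

Lemma op_norm_lub T :
  is_lub_Rbar (fun y => exists x : V, norm x <= 1 /\ y = norm (T x))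
    (Finite (op_norm T)).
Proof.
unfold op_norm.
set (E := fun y => exists x : V, norm x <= 1 /\ y = norm (T x)).
pose proof (Lub_Rbar_correct E) as hl.
destruct (linear_norm _ (op_linear T)) as [M [M0 hM]].
assert (hub : is_ub_Rbar E (Finite M)).
{ intros y [x [hx ->]]; simpl.
  apply Rle_trans with (1 := hM x).
  rewrite <- (Rmult_1_r M) at 2; apply Rmult_le_compat_l; lra. }
assert (h0 : E (norm (T zero))).
{ exists zero; split; [rewrite norm_zero; lra | reflexivity]. }
destruct (Lub_Rbar E) as [r | |] eqn:e; simpl.
- exact hl.
- destruct (proj2 hl _ hub).
- destruct (proj1 hl _ h0).
Qed.

Lemma op_norm_ub T (x : V) : norm x <= 1 -> norm (T x) <= op_norm T.
Proof.
intros hx; apply (proj1 (op_norm_lub T)); now exists x.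
Qed.

Lemma op_norm_le T (M : R) :
  (forall x : V, norm x <= 1 -> norm (T x) <= M) -> op_norm T <= M.
Proof.
intros h; apply (proj2 (op_norm_lub T) (Finite M)).
intros y [x [hx ->]]; now apply h.
Qed.

Lemma op_norm_ge0 T : 0 <= op_norm T.
Proof.
apply Rle_trans with (norm (T zero)); [apply norm_ge_0 |].
apply op_norm_ub; rewrite norm_zero; lra.
Qed.

Lemma op_norm_bound T (x : V) : norm (T x) <= op_norm T * norm x.
Proof.
destruct (Req_dec (norm x) 0) as [h0 | h0].
- rewrite (norm_eq_zero _ h0), (linear_zero _ (op_linear T)), !norm_zero; lra.
- pose proof (norm_ge_0 x) as hx.
  assert (hp : 0 < norm x) by lra.
  set (n := RtoC (norm x) : C_AbsRing).
  set (n' := RtoC (/ norm x) : C_AbsRing).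
  assert (hn : abs n = norm x).
  { change (Cmod (RtoC (norm x)) = norm x); rewrite Cmod_R, Rabs_pos_eq; lra. }
  assert (hn' : abs n' = / norm x).
  { change (Cmod (RtoC (/ norm x)) = / norm x).
    rewrite Cmod_R, Rabs_pos_eq; [reflexivity |].
    now apply Rlt_le, Rinv_0_lt_compat. }
  assert (e : x = scal n (scal n' x)).
  { rewrite scal_assoc.
    assert (e1 : mult n n' = one).
    { change (Cmult (RtoC (norm x)) (RtoC (/ norm x)) = RtoC 1).
      rewrite <- RtoC_mult; f_equal; now field. }
    rewrite e1; symmetry; exact (scal_one x). }
  rewrite e at 1; rewrite (linear_scal _ (op_linear T)).
  apply Rle_trans with (1 := norm_scal _ _).
  rewrite hn, Rmult_comm; apply Rmult_le_compat_r; [exact hx |].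
  apply op_norm_ub.
  apply Rle_trans with (1 := norm_scal _ _).
  rewrite hn'; right; now field.
Qed.

Lemma op_norm_triangle S T : op_norm (op_add S T) <= op_norm S + op_norm T.
Proof.
apply op_norm_le; intros x hx; simpl.
apply Rle_trans with (1 := norm_triangle _ _).
apply Rplus_le_compat; now apply op_norm_ub.
Qed.

Lemma op_norm_scal (a : C) T : op_norm (op_scal a T) <= Cmod a * op_norm T.
Proof.
apply op_norm_le; intros x hx; simpl.
apply Rle_trans with (1 := norm_scal _ _).
apply Rmult_le_compat_l; [apply Cmod_ge_0 | now apply op_norm_ub].
Qed.

Lemma op_norm_eq0 T : op_norm T = 0 -> T = op_zero.
Proof.
intros h; apply bop_ext; intros x; apply norm_eq_zero.
apply Rle_antisym; [| apply norm_ge_0].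
apply Rle_trans with (1 := op_norm_bound T x); rewrite h; lra.
Qed.

Lemma op_addC S T : op_add S T = op_add T S.
Proof. apply bop_ext; intros x; apply plus_comm. Qed.

Lemma op_addA S T U : op_add S (op_add T U) = op_add (op_add S T) U.
Proof. apply bop_ext; intros x; apply plus_assoc. Qed.

Lemma op_add0 T : op_add T op_zero = T.
Proof. apply bop_ext; intros x; apply plus_zero_r. Qed.

Lemma op_addN T : op_add T (op_neg T) = op_zero.
Proof. apply bop_ext; intros x; exact (plus_opp_r (T x)). Qed.

Definition bop_AbelianMonoid_mixin :=
  AbelianMonoid.Mixin _ op_add op_zero op_addC op_addA op_add0.

Canonical bop_AbelianMonoid :=
  AbelianMonoid.Pack (bounded_operator V) bop_AbelianMonoid_mixin
    (bounded_operator V).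

Definition bop_AbelianGroup_mixin :=
  AbelianGroup.Mixin bop_AbelianMonoid op_neg op_addN.

Canonical bop_AbelianGroup :=
  AbelianGroup.Pack (bounded_operator V)
    (AbelianGroup.Class _ bop_AbelianMonoid_mixin bop_AbelianGroup_mixin)
    (bounded_operator V).

Lemma op_scalA (a b : C_AbsRing) T :
  op_scal a (op_scal b T) = op_scal (mult a b) T.
Proof. apply bop_ext; intros x; exact (scal_assoc a b (T x)). Qed.

Lemma op_scal1 T : op_scal (one : C_AbsRing) T = T.
Proof. apply bop_ext; intros x; exact (scal_one (T x)). Qed.

Lemma op_scalDr (a : C_AbsRing) S T :
  op_scal a (op_add S T) = op_add (op_scal a S) (op_scal a T).
Proof. apply bop_ext; intros x; exact (scal_distr_l a (S x) (T x)). Qed.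

Lemma op_scalDl (a b : C_AbsRing) T :
  op_scal (plus a b) T = op_add (op_scal a T) (op_scal b T).
Proof. apply bop_ext; intros x; exact (scal_distr_r a b (T x)). Qed.

Definition bop_ModuleSpace_mixin :=
  ModuleSpace.Mixin C_AbsRing bop_AbelianGroup op_scal
    op_scalA op_scal1 op_scalDr op_scalDl.

Canonical bop_ModuleSpace :=
  ModuleSpace.Pack C_AbsRing (bounded_operator V)
    (ModuleSpace.Class _ _ _ bop_ModuleSpace_mixin) (bounded_operator V).

Definition op_ball S (e : R) T : Prop := op_norm (minus T S) < e.

Lemma op_ball_center S (e : posreal) : op_ball S e S.
Proof.
unfold op_ball; rewrite minus_eq_zero.
apply Rle_lt_trans with (2 := cond_pos e).
apply op_norm_le; intros x hx.
change (norm (zero : V) <= 0); rewrite norm_zero; lra.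
Qed.

Lemma op_ball_sym S T (e : R) : op_ball S e T -> op_ball T e S.
Proof.
unfold op_ball; intros h; apply Rle_lt_trans with (2 := h).
apply op_norm_le; intros x hx.
change (norm (minus (S x) (T x)) <= op_norm (minus T S)).
rewrite <- (opp_minus (T x) (S x)), norm_opp.
exact (op_norm_ub (minus T S) x hx).
Qed.

Lemma op_ball_triangle S T U (e1 e2 : R) :
  op_ball S e1 T -> op_ball T e2 U -> op_ball S (e1 + e2) U.
Proof.
unfold op_ball; intros h1 h2.
rewrite (minus_trans T).
apply Rle_lt_trans with (1 := op_norm_triangle _ _).
rewrite Rplus_comm; now apply Rplus_lt_compat.
Qed.

Definition bop_UniformSpace_mixin :=
  UniformSpace.Mixin _ op_zero op_ball
    op_ball_center op_ball_sym op_ball_triangle.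

Canonical bop_UniformSpace :=
  UniformSpace.Pack (bounded_operator V) bop_UniformSpace_mixin
    (bounded_operator V).

Canonical bop_NormedModuleAux :=
  NormedModuleAux.Pack C_AbsRing (bounded_operator V)
    (NormedModuleAux.Class _ _ (ModuleSpace.class _ bop_ModuleSpace)
       bop_UniformSpace_mixin)
    (bounded_operator V).

Lemma op_ball_norm1 S T (e : R) : op_norm (minus T S) < e -> ball S e T.
Proof. exact (fun h => h). Qed.

Lemma op_ball_norm2 S T (e : posreal) :
  ball S e T -> op_norm (minus T S) < 1 * e.
Proof. rewrite Rmult_1_l; exact (fun h => h). Qed.

Definition bop_NormedModule_mixin :=
  NormedModule.Mixin C_AbsRing bop_NormedModuleAux op_norm 1
    op_norm_triangle op_norm_scal op_ball_norm1 op_ball_norm2 op_norm_eq0.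

Canonical bop_NormedModule :=
  NormedModule.Pack C_AbsRing (bounded_operator V)
    (NormedModule.Class _ _ _ bop_NormedModule_mixin) (bounded_operator V).

End BoundedOperators.

Arguments op_id {V}.

(** The norm is the one induced by [inner], so [inner_norm] also yields
    positive definiteness. *)
Record HilbertSpace : Type := {
  hilbert_carrier :> CompleteNormedModule C_AbsRing;
  inner : hilbert_carrier -> hilbert_carrier -> C;
  inner_plus_l : forall x y z, inner (plus x y) z = (inner x z + inner y z)%C;
  inner_scal_l : forall (a : C) x y,
    inner (scal (a : C_AbsRing) x) y = (a * inner x y)%C;
  inner_conj : forall x y, inner y x = Cconj (inner x y);
  inner_norm : forall x, inner x x = RtoC (norm x ^ 2)
}.

Notation "'B(' H ')'" :=
  (bounded_operator (CompleteNormedModule.NormedModule C_AbsRing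
                       (hilbert_carrier H)))
  (at level 0, H at level 99, format "'B(' H ')'").

Definition in_disc (z : C) : Prop := Cmod z < 1.

(** Complex differentiability with respect to the operator norm. *)
Definition holomorphic_on_disc {H : HilbertSpace} (f : C -> B(H)) : Prop :=
  forall z : C, in_disc z -> @ex_derive C_AbsRing (bop_NormedModule H) f z.

Definition bounded_on_disc {H : HilbertSpace} (f : C -> B(H)) : Prop :=
  exists M : R, forall z : C, in_disc z -> norm (f z) <= M.

Definition has_expansion {H : HilbertSpace} (f : C -> B(H)) (A : nat -> B(H))
    : Prop :=
  forall z : C, in_disc z ->
    @is_pseries C_AbsRing (bop_NormedModule H) A z (f z).

Definition Gpoly (l : nat) (c : nat -> R) (w : R) : R :=
  sum_n_m (fun i => c i * w ^ i) 1 l.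

Definition bohr_term {H : HilbertSpace} (A : nat -> B(H)) (z : C) (k : nat) : R :=
  norm (A k) * Cmod z ^ k.

(** [S(z)] is summed from [k = 0], where the term vanishes. *)
Definition area_term {H : HilbertSpace} (A : nat -> B(H)) (z : C) (k : nat) : R :=
  INR k * norm (A k) ^ 2 * Cmod z ^ (2 * k).

Definition area_sum {H : HilbertSpace} (A : nat -> B(H)) (z : C) : R :=
  Series (area_term A z).

Definition bohr_lhs {H : HilbertSpace} (l : nat) (c : nat -> R)
    (A : nat -> B(H)) (z : C) : R :=
  Series (bohr_term A z) + Gpoly l c (area_sum A z).

(** [Series] is total, with a junk value on divergent series. *)
Definition bohr_sums_converge {H : HilbertSpace} (A : nat -> B(H)) (z : C)
    : Prop :=
  ex_series (bohr_term A z) /\ ex_series (area_term A z).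

(* Main.v *)
Require Import Defs.
From Stdlib Require Import Reals Lra Lia.
From Coquelicot Require Import Coquelicot.

Open Scope R_scope.

(** The key is Wiener's inequality [norm (A k) <= 1 - |a0|^2] for [k >= 1].
    Fix [0 < r < 1] and [x], and put [b = r^k A_k x / (1 - |a0|^2)],
    [p(z) = x + conj(a0) z^k b] and [w(z) = a0 x + z^k b].  On the unit circle
    [f(rz)] is a contraction, so [2 Re <f(rz) p(z), w(z)> <= |p(z)|^2 + |w(z)|^2].
    Taking means over the circle, with [b] chosen so that the coefficients of
    [1] and [z^k] in [f(rz) p(z)] are exactly those of [w], this becomes
    [|b| <= |x|]; then [r] tends to [1].  Means are taken over the [N]-th roots
    of unity, [N] tending to infinity, so no integration is needed.

    With [a = |a0|], at [|z| <= 1/3] the Bohr sum is at most [a + (1 - a^2) / 2]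
    and the area sum at most [(3/8)^2 (1 - a^2)^2], so the claim reduces to
    [(1 - a^2)^(2m) <= 4 (1 - a)^2].  Sharpness is witnessed by
    [(a - z) / (1 - a z)] times the identity, whose Bohr sum already exceeds
    [1] when [(1 + 2 a) r > 1]. *)

(** * Means over the unit circle *)

Fixpoint Csum (F : nat -> C) (n : nat) : C :=
  match n with O => RtoC 0 | S m => (Csum F m + F m)%C end.

Lemma Csum_ext F G n :
  (forall j, (j < n)%nat -> F j = G j) -> Csum F n = Csum G n.
Proof.
induction n as [|n IH]; intros h; simpl; [reflexivity|].
rewrite IH, h; auto with arith.
Qed.

Lemma Csum_plus F G n :
  Csum (fun j => F j + G j)%C n = (Csum F n + Csum G n)%C.
Proof. induction n as [|n IH]; simpl; [|rewrite IH]; ring. Qed.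

Lemma Csum_mult (a : C) F n : Csum (fun j => a * F j)%C n = (a * Csum F n)%C.
Proof. induction n as [|n IH]; simpl; [|rewrite IH]; ring. Qed.

Lemma Csum_conj F n : Csum (fun j => Cconj (F j)) n = Cconj (Csum F n).
Proof.
induction n as [|n IH]; simpl; [|rewrite IH, Cplus_conj]; [|reflexivity].
apply injective_projections; simpl; ring.
Qed.

Lemma Csum_const (a : C) n : Csum (fun _ => a) n = (INR n * a)%C.
Proof.
induction n as [|n IH]; [simpl; ring|].
rewrite S_INR, RtoC_plus; simpl; rewrite IH; ring.
Qed.

Lemma Re_Csum_le F (K : R) n :
  (forall j, Re (F j) <= K) -> Re (Csum F n) <= INR n * K.
Proof.
intros h; induction n as [|n IH]; [simpl; lra|].
rewrite S_INR; simpl Csum; specialize (h n).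
change (Re (Csum F n) + Re (F n) <= (INR n + 1) * K); lra.
Qed.

Lemma Cmod_Csum_le F (K : R) n :
  (forall j, Cmod (F j) <= K) -> Cmod (Csum F n) <= INR n * K.
Proof.
intros h; induction n as [|n IH]; [simpl; rewrite Cmod_0; lra|].
rewrite S_INR; simpl Csum; specialize (h n).
apply Rle_trans with (1 := Cmod_triangle _ _); lra.
Qed.

Lemma Csum_geom (w : C) n : (Csum (fun j => w ^ j) n * (1 - w) = 1 - w ^ n)%C.
Proof.
induction n as [|n IH]; simpl Csum; [simpl; ring|].
rewrite Cmult_plus_distr_r, IH, Cpow_S; ring.
Qed.

(** The primitive root of unity exp(2 pi i / N), in real coordinates. *)
Definition root (N : nat) : C := (cos (2 * PI / INR N), sin (2 * PI / INR N)).

Lemma root_pow N n :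
  (root N ^ n)%C = (cos (INR n * (2 * PI / INR N)), sin (INR n * (2 * PI / INR N))).
Proof.
induction n as [|n IH].
- simpl; rewrite Rmult_0_l, cos_0, sin_0; reflexivity.
- rewrite Cpow_S, IH, S_INR, Rmult_plus_distr_r, Rmult_1_l, cos_plus, sin_plus.
  unfold root; apply injective_projections; simpl; ring.
Qed.

Lemma Cmod_root N : Cmod (root N) = 1.
Proof.
unfold Cmod, root; simpl fst; simpl snd.
rewrite <- sqrt_1; f_equal.
rewrite <- (sin2_cos2 (2 * PI / INR N)); unfold Rsqr; ring.
Qed.

Lemma root_pow_N N : (0 < N)%nat -> (root N ^ N)%C = RtoC 1.
Proof.
intros h; rewrite root_pow.
replace (INR N * (2 * PI / INR N)) with (2 * PI)
  by (field; apply not_0_INR; lia).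
now rewrite cos_2PI, sin_2PI.
Qed.

(** With [t = n pi / N] in the open interval from 0 to pi, the real part of the power is
    [cos (2 t) = 1 - 2 sin^2 t], which is below 1. *)
Lemma root_pow_neq1 N n : (0 < n < N)%nat -> (root N ^ n)%C <> RtoC 1.
Proof.
intros [h1 h2]; rewrite root_pow; intros e.
apply (f_equal fst) in e; simpl in e.
apply lt_INR in h1; apply lt_INR in h2; simpl in h1.
set (t := INR n * (PI / INR N)).
replace (INR n * (2 * PI / INR N)) with (2 * t) in e
  by (unfold t; field; lra).
rewrite cos_2a_sin in e.
assert (0 < sin t); [|nra].
pose proof PI_RGT_0.
apply sin_gt_0; unfold t.
- apply Rmult_lt_0_compat; [lra|apply Rdiv_lt_0_compat; lra].
- apply (Rmult_lt_reg_r (INR N)); [lra|].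
  replace (INR n * (PI / INR N) * INR N) with (INR n * PI) by (field; lra).
  rewrite Rmult_comm; apply Rmult_lt_compat_l; lra.
Qed.

Definition root_mean (phi : C -> C) (N : nat) : C :=
  (/ INR N * Csum (fun j => phi (root N ^ j)%C) N)%C.

(** A discrete substitute for the normalized integral over the unit circle: the averages over the
    [N]-th roots of unity tend to [mu]. *)
Definition has_mean (phi : C -> C) (mu : C) : Prop :=
  forall eps : R, 0 < eps -> exists N0, forall N, (N0 < N)%nat ->
    Cmod (root_mean phi N - mu) <= eps.

Lemma Cmod_root_pow N j : Cmod (root N ^ j)%C = 1.
Proof. now rewrite Cmod_pow, Cmod_root, pow1. Qed.

Lemma has_mean_ext phi psi mu :
  (forall z, Cmod z = 1 -> phi z = psi z) -> has_mean phi mu -> has_mean psi mu.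
Proof.
intros e h eps he; destruct (h eps he) as [N0 hN]; exists N0; intros N hlt.
unfold root_mean; rewrite <- (Csum_ext (fun j => phi (root N ^ j)%C)).
- now apply hN.
- intros j _; apply e, Cmod_root_pow.
Qed.

Lemma has_mean_plus phi psi mu nu :
  has_mean phi mu -> has_mean psi nu ->
  has_mean (fun z => phi z + psi z)%C (mu + nu)%C.
Proof.
intros h1 h2 eps he.
destruct (h1 (eps / 2) ltac:(lra)) as [N1 h1'].
destruct (h2 (eps / 2) ltac:(lra)) as [N2 h2'].
exists (max N1 N2); intros N hN.
specialize (h1' N ltac:(lia)); specialize (h2' N ltac:(lia)).
unfold root_mean in *; rewrite Csum_plus.
match goal with |- Cmod ?x <= _ => replace x with
  ((/ INR N * Csum (fun j => phi (root N ^ j)%C) N - mu) +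
   (/ INR N * Csum (fun j => psi (root N ^ j)%C) N - nu))%C by ring end.
apply Rle_trans with (1 := Cmod_triangle _ _); lra.
Qed.

Lemma has_mean_mult (a : C) phi mu :
  has_mean phi mu -> has_mean (fun z => a * phi z)%C (a * mu)%C.
Proof.
intros h eps he.
pose proof (Cmod_ge_0 a) as ha.
destruct (h (eps / (Cmod a + 1))) as [N0 h'].
{ apply Rdiv_lt_0_compat; lra. }
exists N0; intros N hN; specialize (h' N hN).
unfold root_mean in *; rewrite Csum_mult.
match goal with |- Cmod ?x <= _ => replace x with
  (a * (/ INR N * Csum (fun j => phi (root N ^ j)%C) N - mu))%C by ring end.
rewrite Cmod_mult.
apply Rle_trans with (Cmod a * (eps / (Cmod a + 1))).
- now apply Rmult_le_compat_l.
- apply (Rmult_le_reg_r (Cmod a + 1)); [lra|].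
  replace (Cmod a * (eps / (Cmod a + 1)) * (Cmod a + 1)) with (Cmod a * eps)
    by (field; lra).
  nra.
Qed.

Lemma has_mean_conj phi mu :
  has_mean phi mu -> has_mean (fun z => Cconj (phi z)) (Cconj mu).
Proof.
intros h eps he; destruct (h eps he) as [N0 h'].
exists N0; intros N hN; specialize (h' N hN).
unfold root_mean in *; rewrite Csum_conj.
match goal with |- Cmod ?x <= _ => replace x with
  (Cconj (/ INR N * Csum (fun j => phi (root N ^ j)%C) N - mu))%C end.
- now rewrite Cmod_conj.
- assert (hz : INR N <> 0) by (apply not_0_INR; lia).
  rewrite <- (RtoC_inv _ hz), Cminus_conj, Cmult_conj.
  do 2 f_equal; apply injective_projections; simpl; ring.
Qed.

Lemma has_mean_const (a : C) : has_mean (fun _ => a) a.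
Proof.
intros eps he; exists O; intros N hN.
unfold root_mean; rewrite Csum_const.
assert (INR N <> 0) by (apply not_0_INR; lia).
match goal with |- Cmod ?x <= _ => replace x with (RtoC 0) end.
- rewrite Cmod_0; lra.
- field; intros e; apply RtoC_inj in e; contradiction.
Qed.

(** As soon as [N > n], the number [root N ^ n] differs from 1 while its [N]-th power is 1, so the
    geometric sum vanishes and the average is exactly 0. *)
Lemma has_mean_pow n : (0 < n)%nat -> has_mean (fun z => z ^ n)%C (RtoC 0).
Proof.
intros hn eps he; exists n; intros N hN.
unfold root_mean.
rewrite (Csum_ext _ (fun j => (root N ^ n) ^ j)%C)
  by (intros j _; rewrite <- !Cpow_mult_r; f_equal; lia).
pose proof (Csum_geom (root N ^ n)%C N) as e.
rewrite <- Cpow_mult_r, (PeanoNat.Nat.mul_comm n N), Cpow_mult_r, root_pow_N, Cpow_1_l in e by lia.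
pose proof (root_pow_neq1 N n ltac:(lia)) as hne.
match goal with |- Cmod (_ * ?x - _) <= _ => replace x with (RtoC 0) end.
- replace (/ INR N * 0 - 0)%C with (RtoC 0) by ring; rewrite Cmod_0; lra.
- assert (h1 : (1 - root N ^ n)%C <> RtoC 0).
  { intros e0; apply hne; replace (root N ^ n)%C with (1 - (1 - root N ^ n))%C by ring.
    rewrite e0; ring. }
  set (s := Csum _ _) in *.
  replace s with (s * (1 - root N ^ n) / (1 - root N ^ n))%C by (field; exact h1).
  rewrite e; field; exact h1.
Qed.

Lemma has_mean_Re_le phi mu (K : R) :
  has_mean phi mu -> (forall z, Cmod z = 1 -> Re (phi z) <= K) -> Re mu <= K.
Proof.
intros h hK; apply Rnot_lt_le; intros hlt.
destruct (h ((Re mu - K) / 2) ltac:(lra)) as [N0 h'].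
specialize (h' (S N0) (PeanoNat.Nat.lt_succ_diag_r _)).
set (N := S N0) in *.
assert (hN : 0 < INR N) by (apply lt_0_INR; lia).
assert (Re (root_mean phi N) <= K).
{ unfold root_mean; rewrite <- RtoC_inv by lra.
  pose proof (Re_Csum_le (fun j => phi (root N ^ j)%C) K N
    (fun j => hK _ (Cmod_root_pow N j))) as hs.
  set (s := Csum _ _) in *.
  replace (Re (RtoC (/ INR N) * s)%C) with (/ INR N * Re s) by (destruct s; unfold Re; simpl; ring).
  apply (Rmult_le_reg_l (INR N)); [exact hN|].
  rewrite <- Rmult_assoc, Rinv_r; lra. }
pose proof (re_le_Cmod (root_mean phi N - mu)) as h2.
assert (e : Re (root_mean phi N - mu) = Re (root_mean phi N) - Re mu) by reflexivity.
rewrite e in h2.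
pose proof (Rle_abs (- (Re (root_mean phi N) - Re mu))) as h3.
rewrite Rabs_Ropp in h3; lra.
Qed.

(** Means pass to uniform limits on the circle, so a power series can be replaced by its
    truncations. *)
Lemma has_mean_unif phi mu :
  (forall eps : R, 0 < eps -> exists psi,
     has_mean psi mu /\ forall z, Cmod z = 1 -> Cmod (phi z - psi z) <= eps) ->
  has_mean phi mu.
Proof.
intros h eps he.
destruct (h (eps / 2) ltac:(lra)) as [psi [h1 h2]].
destruct (h1 (eps / 2) ltac:(lra)) as [N0 h'].
exists N0; intros N hN; specialize (h' N hN).
assert (hp : 0 < INR N) by (apply lt_0_INR; lia).
(* The difference is written as [phi + (-1) * psi] so that [Csum_plus] and [Csum_mult] split it. *)
pose proof (Cmod_Csum_le (fun j => phi (root N ^ j) + (- RtoC 1) * psi (root N ^ j))%C (eps / 2) N) as hs.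
rewrite Csum_plus, Csum_mult in hs.
unfold root_mean in *.
set (s := Csum (fun j => phi _) N) in *; set (t := Csum _ N) in *.
replace (/ INR N * s - mu)%C with (/ INR N * (s + - RtoC 1 * t) + (/ INR N * t - mu))%C by ring.
apply Rle_trans with (1 := Cmod_triangle _ _).
rewrite Cmod_mult, <- RtoC_inv, Cmod_R, Rabs_pos_eq in * by (try apply Rlt_le, Rinv_0_lt_compat; lra).
assert (/ INR N * Cmod (s + - RtoC 1 * t) <= eps / 2); [|lra].
apply (Rmult_le_reg_l (INR N)); [exact hp|].
rewrite <- Rmult_assoc, Rinv_r, Rmult_1_l by lra.
apply hs; intros j.
replace (phi (root N ^ j) + - RtoC 1 * psi (root N ^ j))%C with
  (phi (root N ^ j) - psi (root N ^ j))%C by ring.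
apply h2, Cmod_root_pow.
Qed.

Lemma Cconj_unit z : Cmod z = 1 -> (z * Cconj z = 1)%C.
Proof. intros h; rewrite <- Cmod2_conj, h; f_equal; ring. Qed.

(** On the circle [Cconj z] is the inverse of [z], so the product is [z] to the power [n - k]. A
    negative exponent is the conjugate of a positive one, and only exponent 0 has a nonzero mean. *)
Lemma has_mean_shifted_pow k n :
  has_mean (fun z => Cconj z ^ k * z ^ n)%C (if Nat.eqb n k then RtoC 1 else RtoC 0).
Proof.
destruct (PeanoNat.Nat.lt_trichotomy n k) as [h | [<- | h]].
- rewrite (proj2 (PeanoNat.Nat.eqb_neq n k)) by lia.
  replace (RtoC 0) with (Cconj (RtoC 0)) by (apply injective_projections; simpl; ring).
  apply has_mean_ext with (fun z => Cconj (z ^ (k - n))%C).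
  2: now apply has_mean_conj, has_mean_pow; lia.
  intros z hz; replace k with (k - n + n)%nat at 2 by lia.
  rewrite Cpow_conj, Cpow_add_r, <- Cmult_assoc, <- Cpow_mult_l, (Cmult_comm (Cconj z) z).
  rewrite (Cconj_unit z hz), Cpow_1_l; ring.
- rewrite PeanoNat.Nat.eqb_refl.
  apply has_mean_ext with (fun _ => RtoC 1); [|apply has_mean_const].
  intros z hz; rewrite <- Cpow_mult_l, (Cmult_comm (Cconj z) z).
  now rewrite (Cconj_unit z hz), Cpow_1_l.
- rewrite (proj2 (PeanoNat.Nat.eqb_neq n k)) by lia.
  apply has_mean_ext with (fun z => z ^ (n - k))%C; [|apply has_mean_pow; lia].
  intros z hz; replace n with (k + (n - k))%nat at 2 by lia.
  rewrite Cpow_add_r, Cmult_assoc, <- Cpow_mult_l, (Cmult_comm (Cconj z) z).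
  rewrite (Cconj_unit z hz), Cpow_1_l; ring.
Qed.

Lemma has_mean_Csum (psi : nat -> C -> C) (mu : nat -> C) m :
  (forall n, has_mean (psi n) (mu n)) ->
  has_mean (fun z => Csum (fun n => psi n z) m) (Csum mu m).
Proof.
intros h; induction m as [|m IH]; simpl; [apply has_mean_const|].
now apply has_mean_plus.
Qed.

(** * Power series on the circle and their coefficients as means *)

Definition Csum_cv (e : nat -> C) (s : C) : Prop :=
  forall eps : R, 0 < eps -> exists M, forall m, (M <= m)%nat ->
    Cmod (Csum e m - s) <= eps.

Lemma Csum_tail (e : nat -> C) (s : C) (K q : R) (N m : nat) :
  0 <= q < 1 -> Csum_cv e s -> (forall n, (N <= n)%nat -> Cmod (e n) <= K * q ^ n) ->
  (N <= m)%nat -> Cmod (s - Csum e m) <= K * q ^ m / (1 - q).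
Proof.
intros hq hs hb hm.
assert (hK : 0 <= K * q ^ m) by (apply Rle_trans with (2 := hb m hm), Cmod_ge_0).
(* The sum of [K * q ^ n] over the block from [m] to [d + m - 1] is kept in closed form, which makes
   the induction on [d] go through. *)
assert (h : forall d, Cmod (Csum e (d + m) - Csum e m) <= K * (q ^ m - q ^ (d + m)) / (1 - q)).
{ induction d as [|d IH]; simpl Nat.add.
  - replace (Csum e m - Csum e m)%C with (RtoC 0) by ring; rewrite Cmod_0.
    right; field; lra.
  - simpl Csum.
    replace (Csum e (d + m) + e (d + m)%nat - Csum e m)%C with
      ((Csum e (d + m) - Csum e m) + e (d + m)%nat)%C by ring.
    apply Rle_trans with (1 := Cmod_triangle _ _).
    specialize (hb (d + m)%nat ltac:(lia)); simpl pow.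
    replace (K * (q ^ m - q * q ^ (d + m)) / (1 - q)) with
      (K * (q ^ m - q ^ (d + m)) / (1 - q) + K * q ^ (d + m)) by (field; lra).
    lra. }
apply Rle_plus_epsilon; intros eps he.
destruct (hs eps he) as [M hM]; specialize (hM (M + m)%nat ltac:(lia)); specialize (h M).
replace (s - Csum e m)%C with
  (- (Csum e (M + m) - s) + (Csum e (M + m) - Csum e m))%C by ring.
apply Rle_trans with (1 := Cmod_triangle _ _); rewrite Cmod_opp.
assert (0 <= K * q ^ (M + m)).
{ apply Rle_trans with (2 := hb (M + m)%nat ltac:(lia)), Cmod_ge_0. }
assert (K * (q ^ m - q ^ (M + m)) / (1 - q) <= K * q ^ m / (1 - q)); [|lra].
apply Rmult_le_compat_r; [apply Rlt_le, Rinv_0_lt_compat; lra|lra].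
Qed.

Lemma pow_small (K q eps : R) (N : nat) : 0 <= q < 1 -> 0 < eps ->
  exists m, (N <= m)%nat /\ K * q ^ m / (1 - q) <= eps.
Proof.
intros hq he.
(* Dividing by [Rabs K + 1] rather than by [K] covers [K <= 0] as well. *)
assert (hd : 0 < eps * (1 - q) / (Rabs K + 1)).
{ pose proof (Rabs_pos K); apply Rdiv_lt_0_compat; [apply Rmult_lt_0_compat|]; lra. }
destruct (pow_lt_1_zero q ltac:(rewrite Rabs_pos_eq; lra) _ hd) as [M hM].
exists (max N M); split; [lia|].
specialize (hM (max N M) ltac:(lia)).
set (m := max N M) in *.
assert (hp : 0 <= q ^ m) by (apply pow_le; lra).
rewrite Rabs_pos_eq in hM by exact hp.
apply (Rmult_le_reg_r (1 - q)); [lra|].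
replace (K * q ^ m / (1 - q) * (1 - q)) with (K * q ^ m) by (field; lra).
pose proof (Rle_abs K); pose proof (Rabs_pos K).
apply Rle_trans with ((Rabs K + 1) * q ^ m); [nra|].
apply Rlt_le, (Rmult_lt_reg_l (/ (Rabs K + 1))); [apply Rinv_0_lt_compat; lra|].
rewrite <- Rmult_assoc, Rinv_l, Rmult_1_l by lra.
unfold Rdiv in hM; lra.
Qed.

Section Series.

Variables (e : nat -> C) (g : C -> C) (K q : R) (N : nat).
Hypothesis hq : 0 <= q < 1.
Hypothesis hg : forall z, Cmod z = 1 -> Csum_cv (fun n => e n * z ^ n)%C (g z).
Hypothesis he : forall n, (N <= n)%nat -> Cmod (e n) <= K * q ^ n.

(** The geometric majorant does not depend on [z], so convergence on the circle is uniform. Asking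
    for [k < m] ensures that the truncation contains the term of degree [k]. *)
Lemma series_unif_approx eps : 0 < eps -> forall k, exists m, (k < m)%nat /\
  forall z, Cmod z = 1 -> Cmod (g z - Csum (fun n => e n * z ^ n)%C m) <= eps.
Proof.
intros hp k; destruct (pow_small K q eps (max N (S k)) hq hp) as [m [h1 h2]].
exists m; split; [lia|]; intros z hz.
apply Rle_trans with (2 := h2).
apply Csum_tail with N; auto; [|lia].
intros n hn; rewrite Cmod_mult, Cmod_pow, hz, pow1, Rmult_1_r; auto.
Qed.

Lemma Csum_select k m : (k < m)%nat ->
  Csum (fun n => e n * (if Nat.eqb n k then RtoC 1 else RtoC 0))%C m = e k.
Proof.
intros h; replace m with (m - S k + S k)%nat by lia.
induction (m - S k)%nat as [|d IH]; simpl Nat.add.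
- simpl Csum; rewrite PeanoNat.Nat.eqb_refl.
  rewrite (Csum_ext _ (fun _ => RtoC 0)).
  + rewrite Csum_const; ring.
  + intros j hj; rewrite (proj2 (PeanoNat.Nat.eqb_neq j k)) by lia; ring.
- change (Csum ?F (S ?n)) with (Csum F n + F n)%C.
  rewrite IH, (proj2 (PeanoNat.Nat.eqb_neq _ k)) by lia; ring.
Qed.

(** The [k]-th Fourier coefficient of a power series is its [k]-th Taylor coefficient: orthogonality
    of the powers settles truncations, and uniform approximation does the rest. *)
Lemma has_mean_coef k : has_mean (fun z => Cconj z ^ k * g z)%C (e k).
Proof.
apply has_mean_unif; intros eps hp.
destruct (series_unif_approx eps hp k) as [m [hm h]].
exists (fun z => Cconj z ^ k * Csum (fun n => e n * z ^ n) m)%C; split.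
- rewrite <- (Csum_select k m hm).
  apply has_mean_ext with (fun z => Csum (fun n => e n * (Cconj z ^ k * z ^ n)) m)%C.
  + intros z _; rewrite <- Csum_mult; apply Csum_ext; intros; ring.
  + apply (has_mean_Csum (fun n z => e n * (Cconj z ^ k * z ^ n))%C).
    intros n; apply has_mean_mult, has_mean_shifted_pow.
- intros z hz.
  replace (Cconj z ^ k * g z - Cconj z ^ k * Csum (fun n => e n * z ^ n) m)%C with
    (Cconj z ^ k * (g z - Csum (fun n => e n * z ^ n) m))%C by ring.
  rewrite Cmod_mult, Cmod_pow, Cmod_conj, hz, pow1, Rmult_1_l; auto.
Qed.

(** A power series has no negative frequencies: after multiplication by [z ^ k] every exponent is
    positive. *)
Lemma has_mean_neg_coef k : (0 < k)%nat -> has_mean (fun z => z ^ k * g z)%C (RtoC 0).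
Proof.
intros hk; apply has_mean_unif; intros eps hp.
destruct (series_unif_approx eps hp k) as [m [hm h]].
exists (fun z => z ^ k * Csum (fun n => e n * z ^ n) m)%C; split.
- replace (RtoC 0) with (Csum (fun n => e n * 0)%C m)
    by (rewrite (Csum_ext _ (fun _ => RtoC 0)), ?Csum_const; intros; ring).
  apply has_mean_ext with (fun z => Csum (fun n => e n * z ^ (k + n)) m)%C.
  + intros z _; rewrite <- Csum_mult; apply Csum_ext; intros; rewrite Cpow_add_r; ring.
  + apply (has_mean_Csum (fun n z => e n * z ^ (k + n))%C).
    intros n; apply has_mean_mult, has_mean_pow; lia.
- intros z hz.
  replace (z ^ k * g z - z ^ k * Csum (fun n => e n * z ^ n) m)%C with
    (z ^ k * (g z - Csum (fun n => e n * z ^ n) m))%C by ring.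
  rewrite Cmod_mult, Cmod_pow, hz, pow1, Rmult_1_l; auto.
Qed.

End Series.

(** * Wiener's inequality for operator coefficients *)

Section InnerProduct.

Variable H : HilbertSpace.
Implicit Types x y z : H.

Lemma inner_plus_r x y z : inner H x (plus y z) = (inner H x y + inner H x z)%C.
Proof.
now rewrite inner_conj, inner_plus_l, Cplus_conj, <- !inner_conj.
Qed.

Lemma inner_scal_r (a : C) x y :
  inner H x (scal (a : C_AbsRing) y) = (Cconj a * inner H x y)%C.
Proof. now rewrite inner_conj, inner_scal_l, Cmult_conj, <- inner_conj. Qed.

Lemma inner_minus_l x y z : inner H (minus x y) z = (inner H x z - inner H y z)%C.
Proof.
replace (minus x y) with (plus x (scal (RtoC (-1) : C_AbsRing) y)).
- rewrite inner_plus_l, inner_scal_l; ring.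
- unfold minus; f_equal.
  transitivity (scal (opp (one : C_AbsRing)) y); [f_equal | exact (scal_opp_one y)].
  apply injective_projections; simpl; ring.
Qed.

Lemma norm_plus_sqr x y :
  norm (plus x y) ^ 2 = norm x ^ 2 + norm y ^ 2 + 2 * Re (inner H x y).
Proof.
apply RtoC_inj; rewrite <- inner_norm.
rewrite inner_plus_l, !inner_plus_r, !inner_norm, (inner_conj H x y).
apply injective_projections; simpl; unfold Re; ring.
Qed.

Lemma norm_scal_sqr (a : C) x : norm (scal (a : C_AbsRing) x) ^ 2 = Cmod a ^ 2 * norm x ^ 2.
Proof.
apply RtoC_inj; rewrite <- inner_norm, inner_scal_l, inner_scal_r, inner_norm.
rewrite RtoC_mult, Cmod2_conj; ring.
Qed.

(** This is the expansion of the nonnegative number [norm (x - y) ^ 2]. *)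
Lemma Re_inner_le x y : 2 * Re (inner H x y) <= norm x ^ 2 + norm y ^ 2.
Proof.
pose proof (norm_plus_sqr x (scal (RtoC (-1) : C_AbsRing) y)) as h.
rewrite inner_scal_r, norm_scal_sqr, Cmod_R in h.
replace (Rabs (-1)) with 1 in h by (rewrite Rabs_left; lra).
set (t := inner H x y) in *.
replace (Re (Cconj (-1) * t)%C) with (- Re t) in h
  by (unfold Re; simpl; ring).
pose proof (pow2_ge_0 (norm (plus x (scal (RtoC (-1) : C_AbsRing) y)))); lra.
Qed.

Lemma Cauchy_Schwarz x y : Cmod (inner H x y) <= norm x * norm y.
Proof.
pose proof (norm_ge_0 x) as hx; pose proof (norm_ge_0 y) as hy.
set (t := inner H x y).
destruct (Req_dec (norm y) 0) as [h0 | h0].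
- assert (e : t = RtoC 0).
  { assert (ey : y = scal (RtoC 0 : C_AbsRing) y)
      by (rewrite (norm_eq_zero _ h0); symmetry; exact (scal_zero_r _)).
    unfold t; rewrite ey, inner_scal_r.
    apply injective_projections; simpl; ring. }
  rewrite e, Cmod_0, h0; lra.
(* With [t] the inner product, the pair [norm y ^ 2 * x] and [t * y] has inner product
   [norm y ^ 2 * Cmod t ^ 2]. The inequality becomes Cauchy-Schwarz squared, times [norm y ^ 2]. *)
- pose proof (Re_inner_le (scal (RtoC (norm y ^ 2) : C_AbsRing) x)
    (scal (t : C_AbsRing) y)) as h.
  rewrite inner_scal_l, inner_scal_r, !norm_scal_sqr, Cmod_R in h.
  change (inner H x y) with t in h.
  rewrite (Cmult_comm (Cconj t)), <- Cmod2_conj, <- RtoC_mult in h.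
  rewrite Rabs_pos_eq in h by apply pow2_ge_0.
  change (Re (RtoC ?u)) with u in h.
  assert (hp : 0 < norm y ^ 2) by (apply pow_lt; lra).
  apply Rsqr_incr_0_var; [|now apply Rmult_le_pos].
  unfold Rsqr; apply (Rmult_le_reg_l (norm y ^ 2)); [exact hp|]; nra.
Qed.

End InnerProduct.

(** The bound [norm_scal] gives one direction; applied to the inverse scalar it gives the other. *)
Lemma norm_scal_C (V : NormedModule C_AbsRing) (a : C) (x : V) :
  norm (scal (a : C_AbsRing) x) = Cmod a * norm x.
Proof.
apply Rle_antisym; [exact (norm_scal (a : C_AbsRing) x)|].
destruct (Req_dec (Cmod a) 0) as [h0 | h0].
- rewrite h0, Rmult_0_l; apply norm_ge_0.
- assert (ha : a <> RtoC 0) by (intros e; apply h0; rewrite e; apply Cmod_0).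
  assert (e : x = scal ((/ a)%C : C_AbsRing) (scal (a : C_AbsRing) x)).
  { rewrite scal_assoc.
    replace (mult ((/ a)%C : C_AbsRing) (a : C_AbsRing)) with (one : C_AbsRing)
      by (change (RtoC 1 = (/ a * a)%C); field; exact ha).
    symmetry; exact (scal_one x). }
  rewrite e at 1.
  pose proof (norm_scal ((/ a)%C : C_AbsRing) (scal (a : C_AbsRing) x)) as h.
  change (abs ((/ a)%C : C_AbsRing)) with (Cmod (/ a)) in h.
  rewrite Cmod_inv in h by exact ha.
  pose proof (Cmod_ge_0 a).
  apply Rle_trans with (Cmod a * (/ Cmod a * norm (scal (a : C_AbsRing) x))).
  + apply Rmult_le_compat_l; auto.
  + right; field; exact h0.
Qed.

Lemma pow_n_Cpow (z : C) n : pow_n (z : C_AbsRing) n = (z ^ n)%C.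
Proof. induction n as [|n IH]; [reflexivity|simpl; now rewrite IH]. Qed.

(** Writes a term of a series as the difference of the errors of two consecutive partial sums, for
    the next lemma. *)
Lemma term_as_difference {G : AbelianGroup} (s t l : G) :
  t = minus (minus (plus s t) l) (minus s l).
Proof.
change (t = plus (minus (plus s t) l) (opp (minus s l))).
rewrite opp_minus, <- minus_trans.
unfold minus; rewrite (plus_comm s), <- plus_assoc.
transitivity (plus t zero); [symmetry; apply plus_zero_r|].
f_equal; symmetry; apply plus_opp_r.
Qed.

Lemma is_series_terms_small (K : AbsRing) (V : NormedModule K) (a : nat -> V) (l : V) :
  is_series a l -> exists N, forall n, (N <= n)%nat -> norm (a n) <= 1.
Proof.
intros h.
destruct (proj1 (filterlim_locally_ball_norm _ _) h (mkposreal (1/2) ltac:(lra))) as [N hN].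
exists (S N); intros n hn; destruct n as [|n]; [lia|].
pose proof (hN n ltac:(lia)) as h1; pose proof (hN (S n) ltac:(lia)) as h2.
unfold ball_norm in *; simpl in *.
rewrite sum_Sn in h2.
rewrite (term_as_difference (sum_n a n) (a (S n)) l).
apply Rle_trans with (1 := norm_triangle _ _).
apply Rle_trans with (1 / 2 + 1 / 2); [apply Rplus_le_compat | lra].
- now apply Rlt_le.
- rewrite norm_opp; now apply Rlt_le.
Qed.

(** * Coefficients of a contractive operator valued power series *)

Section Coefficients.

Variables (H : HilbertSpace) (f : C -> B(H)) (A : nat -> B(H)).
Hypothesis hfA : has_expansion f A.

(** The index shifts by one: [sum_n] includes its upper end, while [Csum] stops just before it. *)
Lemma inner_sum_n (z : C) n (x v : H) :
  inner H (sum_n (fun k => scal (pow_n (z : C_AbsRing) k) (A k)) n x) v =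
  Csum (fun k => inner H (A k x) v * z ^ k)%C (S n).
Proof.
induction n as [|n IH].
- rewrite sum_O.
  change (inner H (scal (pow_n (z : C_AbsRing) 0) (A 0%nat x)) v =
    (0 + inner H (A 0%nat x) v * z ^ 0)%C).
  rewrite inner_scal_l, pow_n_Cpow; simpl; ring.
- rewrite sum_Sn.
  change (inner H (plus (sum_n (fun k => scal (pow_n (z : C_AbsRing) k) (A k)) n x)
    (scal (pow_n (z : C_AbsRing) (S n)) (A (S n) x))) v = 
    (Csum (fun k => inner H (A k x) v * z ^ k) (S n) + inner H (A (S n) x) v * z ^ (S n))%C).
  rewrite inner_plus_l, inner_scal_l, pow_n_Cpow, IH; ring.
Qed.

(** Operator norm convergence implies weak convergence, by Cauchy-Schwarz. *)
Lemma inner_expansion (z : C) (x v : H) : in_disc z ->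
  Csum_cv (fun n => inner H (A n x) v * z ^ n)%C (inner H (f z x) v).
Proof.
intros hz eps he.
pose proof (norm_ge_0 x) as hx; pose proof (norm_ge_0 v) as hv.
(* The added 1 keeps the denominator positive when [x] or [v] is zero. *)
assert (hd : 0 < eps / (norm x * norm v + 1)) by (apply Rdiv_lt_0_compat; nra).
destruct (proj1 (filterlim_locally_ball_norm _ _) (hfA z hz) (mkposreal _ hd)) as [N hN].
exists (S N); intros m hm; destruct m as [|m]; [lia|].
specialize (hN m ltac:(lia)); unfold ball_norm in hN; simpl in hN.
rewrite <- inner_sum_n.
set (T := sum_n _ m) in *.
pose proof (Cauchy_Schwarz H (minus T (f z) x) v) as hc.
replace (inner H (minus T (f z) x) v) with (inner H (T x) v - inner H (f z x) v)%C in hc.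
- apply Rle_trans with (1 := hc).
  pose proof (op_norm_bound _ (minus T (f z)) x) as hb.
  change (op_norm _ (minus T (f z))) with (norm (minus T (f z))) in hb.
  set (d := norm (minus T (f z))) in *.
  assert (d0 : 0 <= d) by apply norm_ge_0.
  apply Rle_trans with (d * norm x * norm v); [now apply Rmult_le_compat_r|].
  apply Rle_trans with (eps / (norm x * norm v + 1) * (norm x * norm v)).
  + rewrite Rmult_assoc; apply Rmult_le_compat_r; [now apply Rmult_le_pos|lra].
  + apply (Rmult_le_reg_r (norm x * norm v + 1)); [nra|].
    replace (eps / (norm x * norm v + 1) * (norm x * norm v) * (norm x * norm v + 1))
      with (eps * (norm x * norm v)) by (field; nra).
    nra.
- symmetry; exact (inner_minus_l H (T x) (f z x) v).
Qed.

(** The series converges at the point [s = (1 + r) / 2], so eventually [norm (A n) * s ^ n <= 1];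
    the ratio is then [q = r / s < 1]. *)
Lemma coef_geometric_bound (r : R) : 0 < r < 1 ->
  exists q N, 0 <= q < 1 /\ forall n, (N <= n)%nat -> norm (A n) * r ^ n <= q ^ n.
Proof.
intros hr; set (s := (1 + r) / 2).
assert (hs : r < s < 1) by (unfold s; lra).
assert (hd : in_disc (RtoC s)) by (unfold in_disc; rewrite Cmod_R, Rabs_pos_eq; lra).
destruct (is_series_terms_small _ _ _ _ (hfA _ hd)) as [N hN].
exists (r / s), N; split.
- split; [apply Rlt_le, Rdiv_lt_0_compat; lra|].
  apply (Rmult_lt_reg_r s); [lra|]; unfold Rdiv; rewrite Rmult_assoc, Rinv_l; lra.
- intros n hn; specialize (hN n hn).
  rewrite pow_n_Cpow, norm_scal_C, Cmod_pow, Cmod_R, Rabs_pos_eq in hN by lra.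
  assert (0 < s ^ n) by (apply pow_lt; lra).
  assert (0 < r ^ n) by (apply pow_lt; lra).
  unfold Rdiv; rewrite Rpow_mult_distr, pow_inv.
  apply (Rmult_le_reg_r (s ^ n)); [lra|].
  replace (r ^ n * / s ^ n * s ^ n) with (r ^ n) by (field; lra).
  replace (norm (A n) * r ^ n * s ^ n) with (r ^ n * (s ^ n * norm (A n))) by ring.
  nra.
Qed.

(** Fourier coefficients of [z -> <f(rz) x, v>]. The radius [r < 1] moves the unit circle inside the
    disc, where the Taylor terms decay geometrically. *)
Lemma inner_circle_means (r : R) (x v : H) : 0 < r < 1 ->
  (forall k, has_mean (fun z => Cconj z ^ k * inner H (f (r * z) x) v)%C
     (r ^ k * inner H (A k x) v)%C) /\
  (forall k, (0 < k)%nat ->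
     has_mean (fun z => z ^ k * inner H (f (r * z) x) v)%C (RtoC 0)).
Proof.
intros hr; destruct (coef_geometric_bound r hr) as [q [N [hq hN]]].
assert (hg : forall z, Cmod z = 1 ->
  Csum_cv (fun n => (r ^ n * inner H (A n x) v) * z ^ n)%C (inner H (f (r * z)%C x) v)).
{ intros z hz eps he.
  destruct (inner_expansion (r * z)%C x v) with (eps := eps) as [M hM]; auto.
  - unfold in_disc; rewrite Cmod_mult, hz, Cmod_R, Rabs_pos_eq; lra.
  - exists M; intros m hm; specialize (hM m hm).
    rewrite (Csum_ext _ (fun n => inner H (A n x) v * (r * z) ^ n)%C); auto.
    intros j _; rewrite Cpow_mult_l; ring. }
assert (he : forall n, (N <= n)%nat ->
  Cmod (r ^ n * inner H (A n x) v)%C <= (norm x * norm v) * q ^ n).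
{ intros n hn; rewrite Cmod_mult, Cmod_pow, Cmod_R, Rabs_pos_eq by lra.
  specialize (hN n hn).
  pose proof (norm_ge_0 x) as hx; pose proof (norm_ge_0 v) as hv.
  assert (0 <= r ^ n) by (apply pow_le; lra).
  apply Rle_trans with (r ^ n * (norm (A n) * norm x * norm v)).
  - apply Rmult_le_compat_l; auto.
    apply Rle_trans with (1 := Cauchy_Schwarz H _ _).
    apply Rmult_le_compat_r; auto; apply op_norm_bound.
  - replace (r ^ n * (norm (A n) * norm x * norm v)) with
      ((norm x * norm v) * (norm (A n) * r ^ n)) by ring.
    apply Rmult_le_compat_l; auto; now apply Rmult_le_pos. }
split; intros k; [|intros hk].
- now apply (has_mean_coef (fun n => r ^ n * inner H (A n x) v)%C _ (norm x * norm v) q N).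
- now apply (has_mean_neg_coef (fun n => r ^ n * inner H (A n x) v)%C _ (norm x * norm v) q N).
Qed.

Hypothesis hf1 : forall z, in_disc z -> norm (f z) <= 1.
Variable a0 : C.
Hypothesis hA0 : A 0%nat = scal (a0 : C_AbsRing) op_id.
Hypothesis ha0 : Cmod a0 < 1.

Lemma coef_bound_scaled (k : nat) (r : R) (x : H) : (0 < k)%nat -> 0 < r < 1 ->
  r ^ k * norm (A k x) <= (1 - Cmod a0 ^ 2) * norm x.
Proof.
intros hk hr.
set (D := 1 - Cmod a0 ^ 2).
assert (hD : 0 < D) by (pose proof (Cmod_ge_0 a0); unfold D; nra).
assert (hrk : 0 < r ^ k) by (apply pow_lt; lra).
(* This scaling gives [r^k A_k x = D b], hence [r^k <A_k x, b> = D Y]. *)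
set (t := r ^ k / D).
assert (ht : 0 < t) by (apply Rdiv_lt_0_compat; lra).
set (b := scal (RtoC t : C_AbsRing) (A k x) : H).
assert (hb : norm b = t * norm (A k x)).
{ unfold b; rewrite norm_scal_C, Cmod_R, Rabs_pos_eq; lra. }
set (X := norm x ^ 2); set (Y := norm b ^ 2).
set (s := inner H x b).
set (p := fun z : C => plus x (scal ((Cconj a0 * z ^ k)%C : C_AbsRing) b) : H).
set (w := fun z : C => plus (scal (a0 : C_AbsRing) x) (scal ((z ^ k)%C : C_AbsRing) b) : H).
(* The squared norms of [p z] and [w z] have the same cross term [2 Re (a0 * Cconj z ^ k * s)].
   Moving both copies to the left leaves a bound that is constant on the circle. *)
assert (hpt : forall z, Cmod z = 1 ->
  Re (inner H (f (r * z)%C (p z)) (w z) - 2 * a0 * Cconj z ^ k * s)%C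
    <= (1 + Cmod a0 ^ 2) * (X + Y) / 2).
{ intros z hz.
  assert (hzk : Cmod (z ^ k) = 1) by (now rewrite Cmod_pow, hz, pow1).
  pose proof (Re_inner_le H (f (r * z)%C (p z)) (w z)) as h1.
  assert (h2 : norm (f (r * z)%C (p z)) ^ 2 <= norm (p z) ^ 2).
  { apply pow_incr; split; [apply norm_ge_0|].
    apply Rle_trans with (1 := op_norm_bound _ _ _).
    rewrite <- (Rmult_1_l (norm (p z))) at 2.
    apply Rmult_le_compat_r; [apply norm_ge_0|].
    apply hf1; unfold in_disc; rewrite Cmod_mult, hz, Cmod_R, Rabs_pos_eq; lra. }
  assert (h3 : norm (p z) ^ 2 = X + Cmod a0 ^ 2 * Y + 2 * Re (a0 * Cconj z ^ k * s)%C).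
  { unfold p; rewrite norm_plus_sqr, inner_scal_r, norm_scal_sqr.
    rewrite Cmod_mult, Cmod_conj, hzk, Rmult_1_r, Cmult_conj, Cconj_conj, Cpow_conj.
    reflexivity. }
  assert (h4 : norm (w z) ^ 2 = Cmod a0 ^ 2 * X + Y + 2 * Re (a0 * Cconj z ^ k * s)%C).
  { unfold w; rewrite norm_plus_sqr, inner_scal_r, inner_scal_l, !norm_scal_sqr.
    rewrite hzk, Cpow_conj; fold X Y s.
    replace (Cconj z ^ k * (a0 * s))%C with (a0 * Cconj z ^ k * s)%C by ring. ring. }
  set (u := inner H (f (r * z)%C (p z)) (w z)) in *.
  replace (2 * a0 * Cconj z ^ k * s)%C with (2 * (a0 * Cconj z ^ k * s))%C by ring.
  set (v := (a0 * Cconj z ^ k * s)%C) in *.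
  replace (Re (u - 2 * v)%C) with (Re u - 2 * Re v) by (unfold Re; simpl; ring).
  lra. }
assert (hA0x : forall y v, inner H (A 0%nat y) v = (a0 * inner H y v)%C).
{ intros y v; rewrite hA0; exact (inner_scal_l H a0 y v). }
assert (hAk : (r ^ k * inner H (A k x) b)%C = RtoC (D * Y)).
{ replace (A k x) with (scal (RtoC (/ t) : C_AbsRing) b : H).
  - rewrite inner_scal_l, inner_norm; fold Y.
    rewrite RtoC_mult, <- RtoC_pow, Cmult_assoc, <- RtoC_mult.
    f_equal; f_equal; unfold t; field; lra.
  - unfold b; rewrite scal_assoc.
    replace (mult (RtoC (/ t) : C_AbsRing) (RtoC t : C_AbsRing)) with (one : C_AbsRing).
    + exact (scal_one (A k x)).
    + change (RtoC 1 = (RtoC (/ t) * RtoC t)%C); rewrite <- RtoC_mult; f_equal; field; lra. }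
assert (hmean : has_mean (fun z => inner H (f (r * z)%C (p z)) (w z) - 2 * a0 * Cconj z ^ k * s)%C
  (RtoC (Cmod a0 ^ 2 * X + Y))).
{ destruct (inner_circle_means r x x hr) as [mxx _].
  destruct (inner_circle_means r x b hr) as [mxb _].
  destruct (inner_circle_means r b x hr) as [_ mbx].
  destruct (inner_circle_means r b b hr) as [mbb _].
  specialize (mxx O); specialize (mxb k); specialize (mbx k hk); specialize (mbb O).
  pose proof (has_mean_conj _ _ (has_mean_pow k hk)) as mk.
  rewrite hAk in mxb; rewrite hA0x, inner_norm in mxx, mbb.
  (* The four products in [<f(rz) p(z), w(z)>] have means [|a0|^2 X], [D Y], 0 and [|a0|^2 Y], and
     the subtracted cross term has mean 0. Since [D + |a0|^2 = 1], the total is [|a0|^2 X + Y]. *)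
  pose proof (has_mean_plus _ _ _ _
    (has_mean_plus _ _ _ _
      (has_mean_plus _ _ _ _
         (has_mean_plus _ _ _ _ (has_mean_mult (Cconj a0) _ _ mxx) mxb)
         (has_mean_mult (Cconj a0 * Cconj a0)%C _ _ mbx))
      (has_mean_mult (Cconj a0) _ _ mbb))
    (has_mean_mult (- (2 * a0 * s))%C _ _ mk)) as m.
  fold X Y in m.
  match type of m with has_mean _ ?mu => replace mu with (RtoC (Cmod a0 ^ 2 * X + Y)) in m end.
  - revert m; apply has_mean_ext; intros z hz.
    unfold p, w.
    rewrite (linear_plus _ (op_linear (f (r * z)%C))), (linear_scal _ (op_linear (f (r * z)%C))).
    rewrite inner_plus_l, !inner_plus_r, !inner_scal_r, !inner_scal_l.
    rewrite !Cpow_conj.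
    assert (e : (z ^ k * Cconj z ^ k)%C = RtoC 1)
      by (now rewrite <- Cpow_mult_l, Cconj_unit, Cpow_1_l).
    simpl (Cconj z ^ 0)%C.
    set (g := f (r * z)%C); rewrite ?inner_scal_r.
    set (u1 := inner H (g x) x); set (u2 := inner H (g x) b);
    set (u3 := inner H (g b) x); set (u4 := inner H (g b) b).
    transitivity (Cconj a0 * (1 * u1) + Cconj z ^ k * u2 + Cconj a0 * Cconj a0 * (z ^ k * u3) +
      Cconj a0 * ((z ^ k * Cconj z ^ k) * u4) + - (2 * a0 * s) * Cconj z ^ k)%C;
      [rewrite e|]; ring.
  - simpl (RtoC r ^ 0)%C.
    replace (RtoC (Cmod a0 ^ 2 * X + Y)) with (RtoC (Cmod a0 ^ 2) * X + (RtoC (Cmod a0 ^ 2) + RtoC D) * Y)%C.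
    + replace (Cconj 0) with (RtoC 0) by (apply injective_projections; simpl; ring).
      rewrite Cmod2_conj, RtoC_mult; ring.
    + rewrite <- RtoC_plus, <- !RtoC_mult, <- RtoC_plus; f_equal; unfold D; ring. }
pose proof (has_mean_Re_le _ _ _ hmean hpt) as h.
change (Re (RtoC ?u)) with u in h.
(* The inequality [|a0|^2 X + Y <= (1 + |a0|^2) (X + Y) / 2] rearranges to [D Y <= D X]. *)
assert (hYX : Y <= X).
{ apply (Rmult_le_reg_l D); [exact hD|]; unfold D; lra. }
assert (hbx : norm b <= norm x).
{ apply Rsqr_incr_0_var; [unfold Rsqr; unfold X, Y in hYX; lra|apply norm_ge_0]. }
replace (r ^ k * norm (A k x)) with (D * norm b).
- now apply Rmult_le_compat_l; [lra|].
- rewrite hb; unfold t; field; lra.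
Qed.

(** The passage [r -> 1], made quantitative by Bernoulli's inequality for [r = 1 - e]. *)
Lemma le_of_pow_mult_le (u v : R) k : 0 <= u ->
  (forall r, 0 < r < 1 -> r ^ k * u <= v) -> u <= v.
Proof.
intros hu h.
assert (hB : forall e, 0 < e < 1 -> 1 - INR k * e <= (1 - e) ^ k).
{ intros e he; clear h; induction k as [|k IH]; [simpl; lra|].
  rewrite S_INR; simpl; pose proof (pos_INR k); nra. }
apply Rle_plus_epsilon; intros eps he.
pose proof (pos_INR k) as hk.
(* Bernoulli loses at most [k * e * u], which is at most [M * e <= eps]; the added 1 makes [M] a
   safe divisor. *)
set (M := INR k * u + 1).
assert (hM : 1 <= M) by (unfold M; nra).
set (e := Rmin (1 / 2) (eps / M)).
assert (he1 : e <= 1/2) by apply Rmin_l.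
assert (he2 : e <= eps / M) by apply Rmin_r.
assert (he0 : 0 < e).
{ unfold e; apply Rmin_glb_lt; [lra|apply Rdiv_lt_0_compat; lra]. }
specialize (hB e ltac:(lra)); specialize (h (1 - e) ltac:(lra)).
assert (M * e <= eps).
{ apply Rle_trans with (M * (eps / M)); [apply Rmult_le_compat_l; lra|right; field; lra]. }
unfold M in *; nra.
Qed.

Lemma operator_Wiener_inequality (k : nat) : (0 < k)%nat ->
  norm (A k) <= 1 - Cmod a0 ^ 2.
Proof.
intros hk; apply op_norm_le; intros x hx.
apply (le_of_pow_mult_le _ _ k (norm_ge_0 _)); intros r hr.
apply Rle_trans with (1 := coef_bound_scaled k r x hk hr).
pose proof (Cmod_ge_0 a0); pose proof (norm_ge_0 x).
rewrite <- (Rmult_1_r (1 - Cmod a0 ^ 2)) at 2; apply Rmult_le_compat_l; nra.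
Qed.

End Coefficients.

(** * Bohr's inequality *)

Lemma sum_n_incr (u : nat -> R) : (forall n, 0 <= u n) ->
  forall n, sum_n u n <= sum_n u (S n).
Proof. intros h n; rewrite sum_Sn; specialize (h (S n)); unfold plus; simpl; lra. Qed.

(** Monotone convergence. Summability comes together with the bound, so [Series] denotes a genuine
    sum. *)
Lemma Series_bounded (u : nat -> R) (M : R) :
  (forall n, 0 <= u n) -> (forall n, sum_n u n <= M) ->
  ex_series u /\ 0 <= Series u <= M.
Proof.
intros h0 hM.
destruct (ex_finite_lim_seq_incr (sum_n u) M (sum_n_incr u h0) hM) as [s hs].
assert (e : is_series u s) by exact hs.
split; [now exists s|]; rewrite (is_series_unique _ _ e); split.
- apply (is_lim_seq_le (fun _ => 0) (sum_n u) 0 s); [|apply is_lim_seq_const|exact hs].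
  induction n as [|n IH]; [rewrite sum_O; apply h0|].
  apply Rle_trans with (1 := IH), sum_n_incr, h0.
- apply (is_lim_seq_le (sum_n u) (fun _ => M) s M); [exact hM|exact hs|apply is_lim_seq_const].
Qed.

Lemma sum_n_le_loc (u v : nat -> R) : (forall n, u n <= v n) ->
  forall n, sum_n u n <= sum_n v n.
Proof. intros h n; now apply sum_n_m_le. Qed.

Lemma sum_pow_le (x : R) n : 0 <= x < 1 ->
  sum_n (pow x) n <= 1 / (1 - x).
Proof.
intros hx.
assert (e : sum_n (pow x) n = (1 - x ^ S n) / (1 - x)).
{ induction n as [|n IH]; [rewrite sum_O|rewrite sum_Sn, IH; unfold plus; simpl AbelianMonoid.plus];
  simpl; field; lra. }
rewrite e; apply Rmult_le_compat_r; [apply Rlt_le, Rinv_0_lt_compat; lra|].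
pose proof (pow_le x (S n) ltac:(lra)); lra.
Qed.

Lemma sum_arith_geom_le (x : R) n : 0 <= x < 1 ->
  sum_n (fun k => INR k * x ^ k) n <= x / (1 - x) ^ 2.
Proof.
intros hx.
(* Closed form of the partial sum: the full sum minus an explicit nonnegative tail. *)
assert (e : sum_n (fun k => INR k * x ^ k) n =
  x / (1 - x) ^ 2 - (INR n * (1 - x) + 1) / (1 - x) ^ 2 * x ^ S n).
{ induction n as [|n IH].
  - rewrite sum_O; simpl; field; lra.
  - rewrite sum_Sn, IH, S_INR.
    change (plus ?a ?b) with (a + b); simpl; field; lra. }
rewrite e.
assert (0 <= (INR n * (1 - x) + 1) / (1 - x) ^ 2 * x ^ S n); [|lra].
pose proof (pos_INR n).
apply Rmult_le_pos; [|apply pow_le; lra].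
apply Rmult_le_pos; [nra|].
apply Rlt_le, Rinv_0_lt_compat, pow_lt; lra.
Qed.

Lemma sum_n_m_le_loc (u v : nat -> R) n m :
  (forall k, (n <= k <= m)%nat -> u k <= v k) -> sum_n_m u n m <= sum_n_m v n m.
Proof.
intros h.
(* Replacing [v] by the maximum, equal to it on the range, turns the local comparison into one valid
   at every index. *)
rewrite (sum_n_m_ext_loc v (fun k => Rmax (u k) (v k))).
- apply sum_n_m_le; intros; apply Rmax_l.
- intros k hk; rewrite Rmax_right; auto.
Qed.

Lemma sum_n_m_mult_l_R (a : R) (u : nat -> R) n m :
  sum_n_m (fun k => a * u k) n m = a * sum_n_m u n m.
Proof. exact (sum_n_m_mult_l (K := R_Ring) a u n m). Qed.

Lemma sum_n_mult_l_R (a : R) (u : nat -> R) n :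
  sum_n (fun k => a * u k) n = a * sum_n u n.
Proof. apply sum_n_m_mult_l_R. Qed.

(** Only an inequality, since the identity has norm 0 on the zero space. *)
Lemma norm_op_id_le {H : HilbertSpace} : norm (op_id : B(H)) <= 1.
Proof. now apply op_norm_le. Qed.

(** * The estimate for [Cmod z <= 1 / 3] *)

Section Bohr.

Variables (H : HilbertSpace) (l : nat) (c : nat -> R).
Hypothesis hc : forall i : nat, (1 <= i <= l)%nat -> 0 < c i.
Hypothesis hG :
  sum_n_m (fun m => 8 * (2 * INR m - 1) * c m * (3 / 8) ^ (2 * m)) 1 l <= 1.

Lemma Gpoly_ge0 (s : R) : 0 <= s -> 0 <= Gpoly l c s.
Proof.
intros hs; apply Rle_trans with (sum_n_m (fun _ => 0) 1 l).
- rewrite sum_n_m_const; lra.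
- apply sum_n_m_le_loc; intros k hk.
  apply Rmult_le_pos; [apply Rlt_le; auto | now apply pow_le].
Qed.

(** The comparison is termwise: [s^m <= 4 (1 - a)^2 (3/8)^(2m)], and since [2m - 1 >= 1] the term
    [c_m s^m] is at most [(1 - a)^2 / 2] times the corresponding term of [hG]. *)
Lemma Gpoly_le (a s : R) : 0 <= a < 1 -> 0 <= s <= 9 / 64 * (1 - a ^ 2) ^ 2 ->
  Gpoly l c s <= (1 - a) ^ 2 / 2.
Proof.
intros ha hs.
apply Rle_trans with (sum_n_m (fun m => (1 - a) ^ 2 / 2 *
  (8 * (2 * INR m - 1) * c m * (3 / 8) ^ (2 * m))) 1 l).
- apply sum_n_m_le_loc; intros k hk; specialize (hc k hk).
  assert (hk1 : 1 <= INR k) by (apply (le_INR 1); lia).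
  assert (h1 : s ^ k <= (3 / 8) ^ (2 * k) * ((1 - a ^ 2) ^ 2) ^ k).
  { rewrite pow_mult, <- Rpow_mult_distr; apply pow_incr; split; [lra|].
    replace ((3 / 8) ^ 2) with (9 / 64) by field; lra. }
  (* One factor is [(1 + a)^2 (1 - a)^2 <= 4 (1 - a)^2]; the other [k - 1] factors are at most 1. *)
  assert (h2 : ((1 - a ^ 2) ^ 2) ^ k <= 4 * (1 - a) ^ 2).
  { destruct k as [|k]; [lia|]; simpl pow at 1.
    assert (hu : 0 <= 1 - a ^ 2 <= 1) by nra.
    assert (h0 : 0 <= (1 - a ^ 2) ^ 2 <= 1) by (split; [apply pow2_ge_0 | nra]).
    assert (h3 : ((1 - a ^ 2) ^ 2) ^ k <= 1 ^ k) by (apply pow_incr; exact h0).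
    rewrite pow1 in h3.
    assert (h4 : (1 - a ^ 2) ^ 2 <= 4 * (1 - a) ^ 2).
    { replace ((1 - a ^ 2) ^ 2) with ((1 + a) ^ 2 * (1 - a) ^ 2) by ring.
      apply Rmult_le_compat_r; [apply pow2_ge_0|nra]. }
    assert (h5 : 0 <= ((1 - a ^ 2) ^ 2) ^ k) by (apply pow_le; lra).
    change ((1 - a ^ 2) ^ 2 * ((1 - a ^ 2) ^ 2) ^ k <= 4 * (1 - a) ^ 2).
    apply Rle_trans with ((1 - a ^ 2) ^ 2 * 1); [apply Rmult_le_compat_l|]; lra. }
  assert (hp : 0 < (3 / 8) ^ (2 * k)) by (apply pow_lt; lra).
  set (P := (3 / 8) ^ (2 * k)) in *.
  apply Rle_trans with (c k * (P * (4 * (1 - a) ^ 2))).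
  + apply Rmult_le_compat_l; [lra|].
    apply Rle_trans with (1 := h1); apply Rmult_le_compat_l; lra.
  + replace ((1 - a) ^ 2 / 2 * (8 * (2 * INR k - 1) * c k * P)) with
      (c k * (P * (4 * (1 - a) ^ 2)) * (2 * INR k - 1)) by field.
    rewrite <- (Rmult_1_r (c k * _)) at 1.
    apply Rmult_le_compat_l; [|lra].
    pose proof (pow2_ge_0 (1 - a)).
    apply Rmult_le_pos; [lra|apply Rmult_le_pos; lra].
- rewrite sum_n_m_mult_l_R.
  rewrite <- (Rmult_1_r ((1 - a) ^ 2 / 2)) at 2.
  apply Rmult_le_compat_l; [pose proof (pow2_ge_0 (1 - a)); lra | exact hG].
Qed.

Lemma Bohr_inequality (A : nat -> B(H)) (a : R) (z : C) :
  0 <= a < 1 -> norm (A 0%nat) <= a ->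
  (forall k, (0 < k)%nat -> norm (A k) <= 1 - a ^ 2) -> Cmod z <= 1 / 3 ->
  bohr_sums_converge A z /\ bohr_lhs l c A z <= 1.
Proof.
intros ha h0 hA hz.
pose proof (Cmod_ge_0 z) as hz0.
set (r := Cmod z) in *.
assert (hD : 0 <= 1 - a ^ 2) by nra.
assert (hb : forall n, sum_n (bohr_term A z) n <= a + (1 - a ^ 2) / 2).
{ intros n.
  (* The constant term [a] is split as [a - (1 - a^2)] plus [1 - a^2], so that the geometric series
     starts at index 0 and contributes [3/2 (1 - a^2)]. *)
  apply Rle_trans with (a - (1 - a ^ 2) + sum_n (fun k => (1 - a ^ 2) * (1 / 3) ^ k) n).
  - induction n as [|n IH].
    + rewrite !sum_O; unfold bohr_term; simpl; lra.
    + rewrite !sum_Sn; change (plus ?u ?v) with (u + v).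
      assert (bohr_term A z (S n) <= (1 - a ^ 2) * (1 / 3) ^ S n); [|lra].
      apply Rmult_le_compat; [apply norm_ge_0|now apply pow_le| |].
      * apply hA; lia.
      * now apply pow_incr.
  - rewrite sum_n_mult_l_R.
    pose proof (sum_pow_le (1 / 3) n ltac:(lra)) as h.
    replace (1 / (1 - 1 / 3)) with (3 / 2) in h by field.
    apply (Rmult_le_compat_l _ _ _ hD) in h; lra. }
assert (hs : forall n, sum_n (area_term A z) n <= 9 / 64 * (1 - a ^ 2) ^ 2).
{ intros n.
  (* Here [(1/3)^(2k) = (1/9)^k], and the sum of [k / 9^k] is [9/64 = (3/8)^2], the source of the
     constant [3/8]. *)
  apply Rle_trans with (sum_n (fun k => (1 - a ^ 2) ^ 2 * (INR k * (1 / 9) ^ k)) n).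
  - apply sum_n_le_loc; intros k; unfold area_term; fold r.
    destruct k as [|k]; [simpl; lra|].
    replace ((1 - a ^ 2) ^ 2 * (INR (S k) * (1 / 9) ^ S k)) with
      (INR (S k) * (1 - a ^ 2) ^ 2 * (1 / 9) ^ S k) by ring.
    rewrite pow_mult.
    apply Rmult_le_compat; [| apply pow_le, pow2_ge_0 | |].
    + apply Rmult_le_pos; [apply pos_INR|apply pow2_ge_0].
    + apply Rmult_le_compat_l; [apply pos_INR|].
      apply pow_incr; split; [apply norm_ge_0|apply hA; lia].
    + apply pow_incr; split; [apply pow2_ge_0|].
      replace (1 / 9) with ((1 / 3) ^ 2) by field; now apply pow_incr.
  - rewrite sum_n_mult_l_R.
    pose proof (sum_arith_geom_le (1 / 9) n ltac:(lra)) as h.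
    replace (1 / 9 / (1 - 1 / 9) ^ 2) with (9 / 64) in h by field.
    pose proof (pow2_ge_0 (1 - a ^ 2)); nra. }
edestruct (Series_bounded (bohr_term A z)) with (2 := hb) as [e1 [_ b1]].
{ intros n; apply Rmult_le_pos; [apply norm_ge_0|now apply pow_le]. }
edestruct (Series_bounded (area_term A z)) with (2 := hs) as [e2 b2].
{ intros n; apply Rmult_le_pos; [apply Rmult_le_pos|now apply pow_le].
  - apply pos_INR.
  - apply pow2_ge_0. }
split; [now split|].
(* The two bounds add up to exactly 1: [a + (1 - a^2) / 2 + (1 - a)^2 / 2 = 1]. *)
unfold bohr_lhs; pose proof (Gpoly_le a _ ha b2) as hg.
fold (area_sum A z) in hg; nra.
Qed.

End Bohr.

(** * Extremal Moebius functions *)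

Section Moebius.

Variables (H : HilbertSpace) (a : R).
Hypothesis ha : 0 < a < 1.

Definition moebius (z : C) : C := ((a - z) / (1 - a * z))%C.

(** Taylor coefficients of [moebius]: multiplying [a - z] by the series of [a^k z^k] gives
    [a^(k+1) - a^(k-1)] in degree [k >= 1]. *)
Definition moebius_coef (k : nat) : R :=
  match k with O => a | S j => - ((1 - a ^ 2) * a ^ j) end.

Definition moebius_op (z : C) : B(H) := scal (moebius z : C_AbsRing) op_id.

Definition moebius_op_coef (k : nat) : B(H) :=
  scal (RtoC (moebius_coef k) : C_AbsRing) op_id.

Lemma Cmod_az_lt (z : C) : in_disc z -> Cmod (a * z) < 1.
Proof.
unfold in_disc; intros h; rewrite Cmod_mult, Cmod_R, Rabs_pos_eq by lra.
pose proof (Cmod_ge_0 z); nra.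
Qed.

Lemma Cminus1_neq0 (w : C) : Cmod w < 1 -> (1 - w)%C <> RtoC 0.
Proof.
intros h e; assert (e1 : w = RtoC 1) by (replace w with (1 - (1 - w))%C by ring; rewrite e; ring).
rewrite e1, Cmod_1 in h; lra.
Qed.

Lemma moebius_den_neq0 (z : C) : in_disc z -> (1 - a * z)%C <> RtoC 0.
Proof. intros h; now apply Cminus1_neq0, Cmod_az_lt. Qed.

(** Rests on the identity [|1 - a z|^2 - |a - z|^2 = (1 - a^2) (1 - |z|^2)]. *)
Lemma Cmod_moebius_le (z : C) : in_disc z -> Cmod (moebius z) <= 1.
Proof.
intros h; pose proof (moebius_den_neq0 z h) as hd.
unfold moebius; rewrite Cmod_div by exact hd.
apply Cmod_gt_0 in hd.
apply (Rmult_le_reg_r (Cmod (1 - a * z))); [exact hd|].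
unfold Rdiv; rewrite Rmult_assoc, Rinv_l, Rmult_1_r, Rmult_1_l by lra.
apply Rsqr_incr_0_var; [|apply Cmod_ge_0].
rewrite !Rsqr_pow2, !Cmod2_alt.
assert (hz : Re z ^ 2 + Im z ^ 2 <= 1).
{ rewrite <- Cmod2_alt; unfold in_disc in h; pose proof (Cmod_ge_0 z); nra. }
assert (h2 : 0 <= (1 - a ^ 2) * (1 - (Re z ^ 2 + Im z ^ 2))) by (apply Rmult_le_pos; nra).
destruct z as [x y]; unfold Re, Im in *; simpl in *; lra.
Qed.

(** An exact remainder, whose factor [(a * z) ^ n] tends to 0 in the disc. *)
Lemma moebius_partial_sum (z : C) n : in_disc z ->
  (sum_n (fun k => RtoC (moebius_coef k) * z ^ k : C)%C n - moebius z =
   (1 - a ^ 2) * z * (a * z) ^ n / (1 - a * z))%C.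
Proof.
intros h; pose proof (moebius_den_neq0 z h) as hd.
induction n as [|n IH].
- rewrite sum_O; unfold moebius; simpl; field; exact hd.
- rewrite sum_Sn.
  change (plus ?u ?v) with (u + v)%C.
  match goal with |- (?s + ?t - ?m)%C = _ => replace (s + t - m)%C with ((s - m) + t)%C by ring end.
  rewrite IH; change (moebius_coef (S n)) with (- ((1 - a ^ 2) * a ^ n)).
  rewrite RtoC_opp, RtoC_mult, RtoC_minus, !RtoC_pow, Cpow_mult_l, Cpow_mult_l, !Cpow_S.
  field; exact hd.
Qed.

Lemma norm_scal_id_le (w : C) : norm (scal (w : C_AbsRing) (op_id : B(H))) <= Cmod w.
Proof.
rewrite norm_scal_C.
apply Rle_trans with (Cmod w * 1); [|lra].
apply Rmult_le_compat_l; [apply Cmod_ge_0|apply norm_op_id_le].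
Qed.

Lemma norm_minus_scal_id_le (u v : C) :
  norm (minus (scal (u : C_AbsRing) (op_id : B(H))) (scal (v : C_AbsRing) op_id)) <=
  Cmod (u - v).
Proof.
apply Rle_trans with (2 := norm_scal_id_le _); right; f_equal.
symmetry; exact (scal_minus_distr_r (K := C_AbsRing) u v (op_id : B(H))).
Qed.

Lemma moebius_expansion : has_expansion moebius_op moebius_op_coef.
Proof.
intros z hz; pose proof (moebius_den_neq0 z hz) as hd; apply Cmod_gt_0 in hd.
pose proof (Cmod_az_lt z hz) as hq.
apply (proj2 (filterlim_locally_ball_norm _ _)); intros eps.
assert (he : 0 < eps * Cmod (1 - a * z)) by (apply Rmult_lt_0_compat; [apply cond_pos|exact hd]).
destruct (pow_lt_1_zero (Cmod (a * z)) ltac:(rewrite Rabs_pos_eq; [exact hq|apply Cmod_ge_0]) _ he) as [N hN].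
exists N; intros n hn; specialize (hN n hn).
unfold ball_norm.
assert (e : sum_n (fun k => scal (pow_n (z : C_AbsRing) k) (moebius_op_coef k)) n =
  scal (sum_n (fun k => RtoC (moebius_coef k) * z ^ k : C)%C n : C_AbsRing) op_id).
{ clear; induction n as [|n IH].
  - rewrite !sum_O; unfold moebius_op_coef; rewrite scal_assoc, pow_n_Cpow.
    f_equal; apply Cmult_comm.
  - rewrite !sum_Sn, IH; unfold moebius_op_coef; rewrite scal_assoc, pow_n_Cpow.
    rewrite (Cmult_comm (moebius_coef (S n))).
    symmetry; exact (scal_distr_r (K := C_AbsRing) _ _ _). }
change (norm (minus (sum_n (fun k => scal (pow_n (z : C_AbsRing) k) (moebius_op_coef k)) n)
  (moebius_op z)) < eps).
rewrite e.
apply Rle_lt_trans with (1 := norm_minus_scal_id_le _ _).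
rewrite moebius_partial_sum by exact hz.
rewrite Cmod_div by (now apply Cmod_gt_0).
apply (Rmult_lt_reg_r (Cmod (1 - a * z))); [exact hd|].
unfold Rdiv; rewrite Rmult_assoc, Rinv_l, Rmult_1_r by lra.
rewrite Rabs_pos_eq in hN by (apply pow_le, Cmod_ge_0).
apply Rle_lt_trans with (2 := hN).
rewrite 2!Cmod_mult, Cmod_pow.
rewrite <- RtoC_pow, <- RtoC_minus, Cmod_R, Rabs_pos_eq by nra.
rewrite <- (Rmult_1_l (Cmod (a * z) ^ n)) at 2.
apply Rmult_le_compat_r; [apply pow_le, Cmod_ge_0|].
unfold in_disc in hz; pose proof (Cmod_ge_0 z); nra.
Qed.

(** The derivative at [x] is [-(1 - a^2) / (1 - a x)^2]; the first order error is exactly quadratic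
    in [y - x]. *)
Lemma moebius_remainder (x y : C) : in_disc x -> in_disc y ->
  (moebius y - moebius x - (y - x) * (- (1 - a ^ 2) / (1 - a * x) ^ 2) =
   (y - x) * (- ((1 - a ^ 2) * a) / ((1 - a * y) * (1 - a * x) ^ 2)) * (y - x))%C.
Proof.
intros hx hy; pose proof (moebius_den_neq0 x hx); pose proof (moebius_den_neq0 y hy).
unfold moebius; field; now split.
Qed.

Lemma Cmod_den_ge (z : C) : in_disc z -> 1 - a <= Cmod (1 - a * z).
Proof.
intros hz.
pose proof (Cmod_triangle (1 - a * z) (a * z)) as h.
replace (1 - a * z + a * z)%C with (RtoC 1) in h by ring.
rewrite Cmod_1, Cmod_mult, Cmod_R, Rabs_pos_eq in h by lra.
unfold in_disc in hz; nra.
Qed.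

Lemma moebius_holomorphic : holomorphic_on_disc moebius_op.
Proof.
intros x hx.
exists (scal ((- (1 - a ^ 2) / (1 - a * x) ^ 2)%C : C_AbsRing) (op_id : B(H))).
split; [apply (is_linear_scal_l (K := C_AbsRing))|].
intros y hy.
pose proof (is_filter_lim_locally_unique (V := AbsRing_NormedModule C_AbsRing) x y hy) as e.
subst y; clear hy.
intros eps.
assert (hd : 0 < 1 - Cmod x) by (unfold in_disc in hx; lra).
assert (he : 0 < eps * (1 - a) ^ 3).
{ apply Rmult_lt_0_compat; [apply cond_pos|apply pow_lt; lra]. }
(* The first bound keeps [y] in the disc. The second absorbs the denominator of the remainder, at
   least [(1 - a)^3] by [Cmod_den_ge], its numerator being at most 1. *)
set (delta := mkposreal _ (Rmin_stable_in_posreal (mkposreal _ hd) (mkposreal _ he))).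
exists delta; intros y hy.
change (Cmod (y - x)%C < Rmin (1 - Cmod x) (eps * (1 - a) ^ 3)) in hy.
pose proof (Rlt_le_trans _ _ _ hy (Rmin_l _ _)) as h1.
pose proof (Rlt_le_trans _ _ _ hy (Rmin_r _ _)) as h2.
assert (hyd : in_disc y).
{ unfold in_disc; replace y with ((y - x) + x)%C by ring.
  apply Rle_lt_trans with (1 := Cmod_triangle _ _); lra. }
unfold moebius_op; rewrite scal_assoc.
change (norm (minus y x)) with (Cmod (y - x)).
apply Rle_trans with
  (Cmod (moebius y - moebius x - (y - x) * (- (1 - a ^ 2) / (1 - a * x) ^ 2))).
{ apply Rle_trans with (2 := norm_minus_scal_id_le _ _); right; do 2 f_equal.
  exact (eq_sym (scal_minus_distr_r (K := C_AbsRing) (moebius y) (moebius x) (op_id : B(H)))). }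
rewrite moebius_remainder by assumption.
rewrite !Cmod_mult; apply Rmult_le_compat_r; [apply Cmod_ge_0|].
pose proof (Cmod_den_ge x hx) as dx; pose proof (Cmod_den_ge y hyd) as dy.
pose proof (moebius_den_neq0 x hx) as nx; pose proof (moebius_den_neq0 y hyd) as ny.
rewrite Cmod_div by (apply Cmult_neq_0; [exact ny|now apply Cpow_nz]).
rewrite Cmod_opp, !Cmod_mult, Cmod_pow.
rewrite <- RtoC_pow, <- RtoC_minus, !Cmod_R, !Rabs_pos_eq by nra.
set (u := Cmod (1 - a * x)) in *; set (v := Cmod (1 - a * y)) in *.
assert (hden : (1 - a) ^ 3 <= v * u ^ 2).
{ replace ((1 - a) ^ 3) with ((1 - a) * (1 - a) ^ 2) by ring.
  apply Rmult_le_compat; try lra; [apply pow2_ge_0|apply pow_incr; lra]. }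
assert (hp : 0 < (1 - a) ^ 3) by (apply pow_lt; lra).
apply (Rmult_le_reg_r (v * u ^ 2)); [lra|].
unfold Rdiv; rewrite !Rmult_assoc, Rinv_l, Rmult_1_r by lra.
pose proof (cond_pos eps) as ep; pose proof (Cmod_ge_0 (y - x)) as d0.
apply Rle_trans with (Cmod (y - x) * 1); [apply Rmult_le_compat_l; [exact d0|nra]|].
apply Rle_trans with (eps * (1 - a) ^ 3); [lra|].
apply Rmult_le_compat_l; lra.
Qed.

Lemma norm_op_id : (exists x : H, x <> zero) -> norm (op_id : B(H)) = 1.
Proof.
intros [x hx]; apply Rle_antisym; [apply norm_op_id_le|].
assert (hp : 0 < norm x).
{ destruct (norm_ge_0 x) as [h|h]; [exact h|].
  destruct hx; exact (norm_eq_zero x (eq_sym h)). }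
pose proof (op_norm_bound _ (op_id : B(H)) x) as h.
change (norm x <= norm (op_id : B(H)) * norm x) in h.
apply (Rmult_le_reg_r (norm x)); [exact hp|lra].
Qed.

Lemma norm_moebius_op_coef k : (exists x : H, x <> zero) ->
  norm (moebius_op_coef k) = Rabs (moebius_coef k).
Proof.
intros hH; unfold moebius_op_coef.
now rewrite norm_scal_C, (norm_op_id hH), Cmod_R, Rmult_1_r.
Qed.

(** After the constant term, the absolute coefficients form a geometric series of ratio
    [a * Cmod z]. *)
Lemma moebius_bohr_series (z : C) : (exists x : H, x <> zero) -> in_disc z ->
  is_series (bohr_term moebius_op_coef z)
    (a + (1 - a ^ 2) * Cmod z / (1 - a * Cmod z)).
Proof.
intros hH hz; unfold in_disc in hz; set (r := Cmod z) in *.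
assert (hr : 0 <= r) by apply Cmod_ge_0.
assert (hq : Rabs (a * r) < 1) by (rewrite Rabs_pos_eq; nra).
pose proof (is_series_scal_l ((1 - a ^ 2) * r) _ _ (is_series_geom _ hq)) as h.
pose proof (is_series_decr_1 (bohr_term moebius_op_coef z)
  (a + (1 - a ^ 2) * r / (1 - a * r))) as h1; apply h1; clear h1.
assert (e0 : bohr_term moebius_op_coef z 0 = a).
{ unfold bohr_term; rewrite norm_moebius_op_coef by exact hH.
  simpl; rewrite Rabs_pos_eq; lra. }
rewrite e0.
match type of h with is_series _ ?s => match goal with |- is_series _ ?t =>
  replace t with s end end.
- revert h; apply is_series_ext; intros n; unfold bohr_term.
  rewrite norm_moebius_op_coef by exact hH; fold r.
  change (scal ?u ?v) with (u * v).
  simpl moebius_coef; rewrite Rabs_Ropp, Rabs_pos_eq.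
  + rewrite Rpow_mult_distr; simpl pow.
    match goal with |- @eq _ ?u ?v => change (@eq R u v) end; ring.
  + apply Rmult_le_pos; [nra|apply pow_le; lra].
- change (scal ?u ?v) with (u * v); change (plus ?u (opp ?v)) with (u + - v).
  match goal with |- @eq _ ?u ?v => change (@eq R u v) end; field; nra.
Qed.

(** For sharpness nonnegativity suffices: [G] then only increases the left side, and the Bohr sum
    alone exceeds 1. *)
Lemma moebius_area_series (z : C) : (exists x : H, x <> zero) -> in_disc z ->
  ex_series (area_term moebius_op_coef z) /\ 0 <= area_sum moebius_op_coef z.
Proof.
intros hH hz; unfold in_disc in hz; set (r := Cmod z) in *.
assert (hr : 0 <= r) by apply Cmod_ge_0.
assert (hcoef : forall k, norm (moebius_op_coef k) <= 1).
{ intros k; rewrite norm_moebius_op_coef by exact hH.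
  destruct k as [|k]; simpl moebius_coef; [rewrite Rabs_pos_eq; lra|].
  assert (hk : 0 <= a ^ k <= 1 ^ k) by (split; [apply pow_le|apply pow_incr]; lra).
  rewrite pow1 in hk.
  rewrite Rabs_Ropp, Rabs_pos_eq by (apply Rmult_le_pos; nra).
  rewrite <- (Rmult_1_r 1); apply Rmult_le_compat; nra. }
edestruct (Series_bounded (area_term moebius_op_coef z)) as [e1 [b1 _]].
- intros n; apply Rmult_le_pos; [apply Rmult_le_pos|now apply pow_le].
  + apply pos_INR.
  + apply pow2_ge_0.
- intros n; apply Rle_trans with (2 := sum_arith_geom_le (r ^ 2) n ltac:(split; nra)).
  apply sum_n_le_loc; intros k; unfold area_term; fold r.
  rewrite <- pow_mult.
  apply Rmult_le_compat_r; [now apply pow_le|].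
  rewrite <- (Rmult_1_r (INR k)) at 2; apply Rmult_le_compat_l; [apply pos_INR|].
  pose proof (hcoef k); pose proof (norm_ge_0 (moebius_op_coef k)); nra.
- now split.
Qed.

End Moebius.

(** * The inequality and the sharpness of [1/3] *)

Theorem lemma3p14 (H : HilbertSpace) (l : nat) (c : nat -> R)
  (hl : (1 <= l)%nat)
  (hc : forall i : nat, (1 <= i <= l)%nat -> 0 < c i)
  (hG : sum_n_m (fun m => 8 * (2 * INR m - 1) * c m * (3 / 8) ^ (2 * m)) 1 l
        <= 1) :
  (forall (f : C -> B(H)) (A : nat -> B(H)) (a0 : C),
      bounded_on_disc f ->
      holomorphic_on_disc f ->
      has_expansion f A ->
      A 0%nat = scal (a0 : C_AbsRing) op_id ->
      Cmod a0 < 1 ->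
      (forall z : C, in_disc z -> norm (f z) <= 1) ->
      forall z : C, Cmod z <= 1 / 3 ->
        bohr_sums_converge A z /\ bohr_lhs l c A z <= 1)
  /\
  ((exists x : H, x <> zero) ->
   forall r : R, 1 / 3 < r < 1 ->
     exists (f : C -> B(H)) (A : nat -> B(H)) (a0 : C),
       holomorphic_on_disc f /\
       has_expansion f A /\
       A 0%nat = scal (a0 : C_AbsRing) op_id /\
       Cmod a0 < 1 /\
       (forall z : C, in_disc z -> norm (f z) <= 1) /\
       forall z : C, Cmod z = r ->
         bohr_sums_converge A z /\ 1 < bohr_lhs l c A z).
Proof.
split.
- intros f A a0 _ _ hfA hA0 ha0 hf1 z hz.
  apply Bohr_inequality with (Cmod a0); auto.
  + split; [apply Cmod_ge_0|exact ha0].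
  + rewrite hA0; apply norm_scal_id_le.
  + intros k hk; now apply (operator_Wiener_inequality H f).
- intros hH r hr.
  (* The condition [(1 + 2 a) r > 1] means [a > (1/r - 1) / 2], a threshold below 1 exactly because
     [r > 1/3]; [a] is the midpoint between it and 1. *)
  set (a := (1 + (/ r - 1) / 2) / 2).
  assert (hi : 1 < / r < 3).
  { split.
    - rewrite <- Rinv_1; apply Rinv_lt_contravar; lra.
    - replace 3 with (/ (1 / 3)) by field; apply Rinv_lt_contravar; lra. }
  assert (ha : 0 < a < 1) by (unfold a; lra).
  assert (har : 1 < r * (1 + 2 * a)).
  { replace 1 with (r * / r) at 1 by (field; lra).
    apply Rmult_lt_compat_l; unfold a; lra. }
  exists (moebius_op H a), (moebius_op_coef H a), (RtoC a).
  split; [now apply moebius_holomorphic|].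
  split; [now apply moebius_expansion|].
  split; [reflexivity|].
  split; [rewrite Cmod_R, Rabs_pos_eq; lra|].
  split.
  + intros z hz; apply Rle_trans with (1 := norm_scal_id_le _ _).
    now apply Cmod_moebius_le.
  + intros z hz.
    assert (hzd : in_disc z) by (unfold in_disc; lra).
    pose proof (moebius_bohr_series H a ha z hH hzd) as hb.
    destruct (moebius_area_series H a ha z hH hzd) as [e1 e2].
    split; [split; [now eexists; apply hb|exact e1]|].
    unfold bohr_lhs; rewrite (is_series_unique _ _ hb), hz.
    pose proof (Gpoly_ge0 l c hc _ e2) as hg.
    assert (h1 : 0 < 1 - a * r) by nra.
    (* Clearing the denominator and cancelling [1 - a] turns this into [1 - a r < (1 + a) r], which
       is [har]. *)
    assert (1 - a < (1 - a ^ 2) * r / (1 - a * r)); [|lra].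
    apply (Rmult_lt_reg_r (1 - a * r)); [exact h1|].
    unfold Rdiv; rewrite Rmult_assoc, Rinv_l, Rmult_1_r by lra.
    nra.
Qed.
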